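(* The contravariant functor $\mathcal{P}:\mathbf{SDS}\to\mathbf{OBD}$ is a full and faithful functor.
   Context: **Bratteli diagrams.** A Bratteli diagram $(V,E)$ consists of a vertex set $V=V_0\sqcup V_1\sqcup\cdots$ with each $V_n$ finite and non-empty and $V_0$ a singleton, and an edge set $E=E_1\sqcup E_2\sqcup\cdots$ with each $E_n$ finite and non-empty, together with maps $r,s:E\to V$ (range, source) such that $r(E_n)\subseteq V_n$, $s(E_n)\subseteq V_{n-1}$, $s^{-1}\{v\}\neq\varnothing$ for all $v\in V$ and $r^{-1}\{v\}\ne\varnothing$ for all $v\in V\setminus V_0$. An ordered Bratteli diagram $(V,E,\geq)$ is a Bratteli diagram with a partial order on $E$ such that $e,e'$ are comparable iff $r(e)=r(e')$. **Edge sets.** An ordered edge set from a finite set $S$ to a finite set $T$ is a finite set $F$ with maps $s:F\to S$, $r:F\to T$ and a linear order on each $r^{-1}\{w\}$, $w\in T$. If $G$ is an ordered edge set from $T$ to $U$, then $F\circ G=\{(e,g)\in F\times G: r(e)=s(g)\}$, with source $s(e)$, range $r(g)$, and order: for $r(g)=r(g')$, $(e,g)<(e',g')$ iff $g<g'$, or $g=g'$ and $e<e'$. Write $F\cong F'$ if there is a bijection $F\to F'$ preserving sources, ranges and order. For $k<l$, $E_{k,l}=E_{k+1}\circ\cdots\circ E_l$; $E_{k,k}$ consists of one edge from $v$ to $v$ for each $v\in V_k$. **The category $\mathbf{OBD}$.** Objects: ordered Bratteli diagrams. An ordered premorphism $f:B=(V,E,\ge)\to C=(W,S,\ge)$ is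 a triple $(F,(f_n)_{n\ge0},\geq)$ where $(f_n)$ is an unbounded sequence of integers with $0=f_0\le f_1\le\cdots$, and $F=F_0\sqcup F_1\sqcup\cdots$ where each $F_n$ is a non-empty finite ordered edge set from $V_n$ to $W_{f_n}$ such that every $v\in V_n$ is the source of some edge of $F_n$ (that is, $s^{-1}\{v\}\neq\varnothing$ for all $v\in V$) and every $w\in W_{f_n}$ is the range of some edge of $F_n$, $F_0$ is a singleton, and $E_{n+1}\circ F_{n+1}\cong F_n\circ S_{f_n,f_{n+1}}$ for all $n\ge0$. The composition of $f:B\to C$ and $g=(G,(g_n),\ge):C\to D$ is $gf=(H,(h_n),\ge)$ with $h_n=g_{f_n}$, $H_n=F_n\circ G_{f_n}$. Premorphisms $f,g:B\to C$ are equivalent if there are positive integers $n_1<m_1<n_2<m_2<\cdots$ with $f_{n_k}<g_{m_k}<f_{n_{k+1}}$ and, for all $k\ge1$, $E_{n_k,m_k}\circ G_{m_k}\cong F_{n_k}\circ S_{f_{n_k},g_{m_k}}$ and $E_{m_k,n_{k+1}}\circ F_{n_{k+1}}\cong G_{m_k}\circ S_{g_{m_k},f_{n_{k+1}}}$. Morphisms in $\mathbf{OBD}$ are equivalence classes $[f]$, with $[g][f]=[gf]$. **The category $\mathbf{SDS}$.** An essentially minimal totally disconnected dynamical system $(X,\varphi,x_0)$ consists of a metrizable compact totally disconnected space $X$, a homeomorphism $\varphi$ of $X$ such that $(X,\varphi)$ has a unique minimal (non-empty closed invariant) subset, and a point $x_0$ of that subset. A Kakutani–Rokhlin partition for it is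 a finite partition $P=\{Z(k,j): 1\le k\le K,\ 1\le j\le J(k)\}$ of $X$ into non-empty clopen sets with $\varphi(Z(k,j))=Z(k,j+1)$ for $1\le j<J(k)$, and such that the top $Z=\bigcup_kZ(k,J(k))$ contains $x_0$ and $\varphi(Z)=\bigcup_kZ(k,1)$; the sequences $(Z(k,1),\ldots,Z(k,J(k)))$ are its towers. A system of Kakutani–Rokhlin partitions is a sequence $\mathcal{R}=(P_n)_{n\ge0}$ of such partitions with $P_0=\{X\}$, $P_{n+1}$ refining $P_n$ (written $P_n\le P_{n+1}$), the tops $Z_n$ of $P_n$ ($n\ge1$) decreasing with intersection $\{x_0\}$, and $\bigcup_nP_n$ a basis for the topology of $X$. Objects of $\mathbf{SDS}$ are quadruples $(X,\varphi,x_0,\mathcal{R})$; morphisms $(X,\varphi,x_0,\mathcal{R})\to(Y,\psi,y_0,\mathcal{S})$ are continuous maps $\alpha:X\to Y$ with $\alpha\circ\varphi=\psi\circ\alpha$ and $\alpha(x_0)=y_0$. **The edge set $E(P,Q)$.** If $P\le Q$ are Kakutani–Rokhlin partitions and the top of $P$ contains the top of $Q$, $E(P,Q)$ is the set of triples $(S,T,k)$ with $S=(Z_1,\ldots,Z_n)$ a tower of $P$, $T=(Y_1,\ldots,Y_m)$ a tower of $Q$, $k\ge0$ an integer with $Y_{k+j}\subseteq Z_j$ for $1\le j\le n$; source $S$, range $T$, and $(S,T,k)\le(S',T',k')$ iff $T=T'$ and $k\le k'$. **The functor $\mathcal{P}$.** On objects with $\mathcal{R}=(P_n)$: $\mathcal{P}(X,\varphi,x_0,\mathcal{R})$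 has $V_n=\{(n,T): T\text{ a tower of }P_n\}$ and $E_n$ the copy $\{(n,S,T,k):(S,T,k)\in E(P_{n-1},P_n)\}$ of $E(P_{n-1},P_n)$ with its order. For a morphism $\alpha:(X,\varphi,x_0,(P_n))\to(Y,\psi,y_0,(Q_n))$, let $\alpha^{-1}(Q_n)$ be the set of inverse images of elements of $Q_n$, a Kakutani–Rokhlin partition for $(X,\varphi,x_0)$; for a tower $S=(Z_1,\ldots,Z_m)$ of $Q_n$ write $\alpha^{-1}(S)=(\alpha^{-1}(Z_1),\ldots,\alpha^{-1}(Z_m))$. Choose integers $0=f_0\le f_1\le\cdots$, unbounded, with $\alpha^{-1}(Q_n)\le P_{f_n}$ and the top of $\alpha^{-1}(Q_n)$ containing the top of $P_{f_n}$; let $F_n=\{(n,S,T,k):(\alpha^{-1}(S),T,k)\in E(\alpha^{-1}(Q_n),P_{f_n})\}$ with source $(n,S)$, range $(f_n,T)$ and the induced order ($F_0$ a single edge). Then $f=(\bigsqcup F_n,(f_n),\ge)$ is an ordered premorphism $\mathcal{P}(Y,\psi,y_0,(Q_n))\to\mathcal{P}(X,\varphi,x_0,(P_n))$ and $\mathcal{P}(\alpha)=[f]$.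
   Formalization: Morphisms of SDS are required to be surjective: for a non-surjective α, some α^{-1}(Q_n) has an empty cell, so P(α) is not defined; e.g. from a point to the fixed point of Z ∪ {∞} with the shift there is a morphism in SDS but none between the diagrams. *)

(* Defs.v *)
From HB Require Import structures.
From mathcomp Require Import all_boot all_order all_algebra finmap.
From mathcomp Require Import boolp classical_sets reals.
From mathcomp Require Import topology_structure compact connected separation_axioms.
From mathcomp Require Import subspace_topology.

Import Order.TTheory GRing.Theory Num.Theory.

Set Implicit Arguments.
Unset Strict Implicit.
Unset Printing Implicit Defensive.

Record category := Category {
  ob :> Type;
  hom : ob -> ob -> Type;
  idm : forall A, hom A A;
  cmp : forall A B C, hom B C -> hom A B -> hom A C;
  cmpA : forall A B C D (h : hom C D) (g : hom B C) (f : hom A B),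
    cmp h (cmp g f) = cmp (cmp h g) f;
  cmp1m : forall A B (f : hom A B), cmp (idm B) f = f;
  cmpm1 : forall A B (f : hom A B), cmp f (idm A) = f }.

Arguments hom {c} A B.
Arguments idm {c} A.
Arguments cmp {c A B C} g f.

Section ContravariantFunctors.
Variables (C D : category) (F0 : C -> D).
Variable F1 : forall X Y : C, hom X Y -> hom (F0 Y) (F0 X).

Definition is_contrafunctor : Prop :=
  (forall X : C, F1 (idm X) = idm (F0 X)) /\
  (forall (X Y Z : C) (b : hom Y Z) (a : hom X Y),
     F1 (cmp b a) = cmp (F1 a) (F1 b)).

Definition is_full : Prop :=
  forall (X Y : C) (m : hom (F0 Y) (F0 X)), exists a : hom X Y, F1 a = m.

Definition is_faithful : Prop :=
  forall (X Y : C) (a b : hom X Y), F1 a = F1 b -> a = b.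

End ContravariantFunctors.

(* [ele_comparable] makes [ele] a linear order on each fibre of [erng], with no
   relation between distinct fibres. *)
Record edge_set (S T : finType) := EdgeSet {
  edge :> finType;
  esrc : edge -> S;
  erng : edge -> T;
  ele : rel edge;
  ele_refl : reflexive ele;
  ele_anti : antisymmetric ele;
  ele_trans : transitive ele;
  ele_comparable : forall e e', (ele e e' || ele e' e) = (erng e == erng e') }.

Arguments esrc {S T} _ _.
Arguments erng {S T} _ _.
Arguments ele {S T} _ _ _.

Lemma ele_rng S T (F : edge_set S T) (e e' : F) :
  ele F e e' -> erng F e = erng F e'.
Proof. by move=> h; apply/eqP; rewrite -ele_comparable h. Qed.

Lemma ele_total S T (F : edge_set S T) (e e' : F) :
  erng F e = erng F e' -> ele F e e' || ele F e' e.
Proof. by move=> h; rewrite ele_comparable h. Qed.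

Section IdEdges.
Variable S : finType.
Fact ide_anti : antisymmetric (@eq_op S). Proof. by move=> x y /andP[/eqP]. Qed.
Fact ide_trans : transitive (@eq_op S).
Proof. by move=> y x z /eqP -> /eqP ->. Qed.
Fact ide_comparable (e e' : S) : (e == e') || (e' == e) = (e == e').
Proof. by rewrite [e' == e]eq_sym orbb. Qed.
Definition id_edges : edge_set S S :=
  @EdgeSet S S S id id eq_op (@eqxx S) ide_anti ide_trans ide_comparable.
End IdEdges.

Section EmptyEdges.
Variables S T : finType.
Definition empty_edges : edge_set S T :=
  @EdgeSet S T void (@of_void S) (@of_void T) (fun _ _ => true)
    (fun e => match e with end) (fun e => match e with end)
    (fun e => match e with end) (fun e => match e with end).
End EmptyEdges.

Section Composition.
Variables (S T U : finType) (F : edge_set S T) (G : edge_set T U).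

Definition ecomp_type : finType := {p : F * G | erng F p.1 == esrc G p.2}.

Definition ecomp_le : rel ecomp_type := fun p q =>
  (((val p).2 != (val q).2) && ele G (val p).2 (val q).2) ||
  (((val p).2 == (val q).2) && ele F (val p).1 (val q).1).

Fact ecomp_refl : reflexive ecomp_le.
Proof. by move=> [[e g] h]; rewrite /ecomp_le /= eqxx !ele_refl. Qed.

Fact ecomp_anti : antisymmetric ecomp_le.
Proof.
move=> [[e g] h] [[e' g'] h']; rewrite /ecomp_le /= => H; apply/val_inj => /=.
have [E|N] := eqVneq g g'.
  move: H; subst g'; rewrite eqxx /= => H.
  by rewrite (@ele_anti _ _ F e e').
move: H; rewrite (eq_sym g' g) (negbTE N) /= !orbF => H.
by case/eqP: N; apply: (@ele_anti _ _ G).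
Qed.

Fact ecomp_trans : transitive ecomp_le.
Proof.
move=> [[e g] h] [[e1 g1] h1] [[e2 g2] h2]; rewrite /ecomp_le /=.
case/orP=> /andP[A B] /orP[/andP[C D]|/andP[C D]].
- apply/orP; left; rewrite (ele_trans B D) andbT.
  apply/eqP => E; subst g2; case/eqP: A; apply: (@ele_anti _ _ G).
  by rewrite B.
- by move/eqP: C => C; subst g2; rewrite A B.
- by move/eqP: A => A; subst g1; rewrite C D.
- move/eqP: A => A; move/eqP: C => C; subst g1 g2.
  by rewrite eqxx (ele_trans B D) orbT.
Qed.

Fact ecomp_comparable (p q : ecomp_type) :
  (ecomp_le p q || ecomp_le q p) = (erng G (val p).2 == erng G (val q).2).
Proof.
move: p q => [[e g] h] [[e' g'] h']; rewrite /ecomp_le /=.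
rewrite [g' == g]eq_sym; have [E|N] /= := eqVneq g g'; last first.
  by rewrite !orbF ele_comparable.
subst g'; rewrite eqxx ele_comparable.
by move: h h' => /= /eqP -> /eqP ->; rewrite eqxx.
Qed.

Definition ecomp : edge_set S U :=
  @EdgeSet S U ecomp_type (fun p => esrc F (val p).1)
    (fun p => erng G (val p).2) ecomp_le
    ecomp_refl ecomp_anti ecomp_trans ecomp_comparable.

End Composition.

Notation "F \oE G" := (ecomp F G) (at level 45, left associativity).

Definition eiso S T (F F' : edge_set S T) : Prop :=
  exists h : F -> F', [/\ bijective h,
    forall e, esrc F' (h e) = esrc F e,
    forall e, erng F' (h e) = erng F e &
    forall e e', ele F' (h e) (h e') = ele F e e'].

Notation "F =~ G" := (eiso F G) (at level 70, no associativity).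

Section IsoTheory.

Lemma eisoI S T (F F' : edge_set S T) (h : F -> F') :
  injective h -> (forall y, exists x, h x = y) ->
  (forall e, esrc F' (h e) = esrc F e) ->
  (forall e, erng F' (h e) = erng F e) ->
  (forall e e', ele F e e' -> ele F' (h e) (h e')) -> F =~ F'.
Proof.
move=> hi hs h1 h2 h3; exists h; split => //.
  exists (fun y => projT1 (cid (hs y))) => [x|y]; last by case: cid.
  by case: cid => z /= /hi.
move=> e e'; apply/idP/idP => [H|]; last exact: h3.
have /ele_total/orP[//|H'] : erng F e = erng F e' by rewrite -!h2 (ele_rng H).
rewrite (hi e e') ?ele_refl //; apply: (@ele_anti _ _ F').
by rewrite H h3.
Qed.

Lemma eiso_refl S T (F : edge_set S T) : F =~ F.
Proof. by exists id; split => //; exists id. Qed.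

Lemma eiso_sym S T (F G : edge_set S T) : F =~ G -> G =~ F.
Proof.
case=> h [[k hk kh] h1 h2 h3]; exists k; split.
- by exists h.
- by move=> e; rewrite -h1 kh.
- by move=> e; rewrite -h2 kh.
- by move=> e e'; rewrite -h3 !kh.
Qed.

Lemma eiso_trans S T (G F H : edge_set S T) : F =~ G -> G =~ H -> F =~ H.
Proof.
case=> h [hb h1 h2 h3] [k [kb k1 k2 k3]]; exists (k \o h); split => /=.
- exact: bij_comp.
- by move=> e; rewrite k1.
- by move=> e; rewrite k2.
- by move=> e e'; rewrite k3.
Qed.

Definition epair S T U (F : edge_set S T) (G : edge_set T U) (e : F) (g : G)
    (h : erng F e = esrc G g) : F \oE G := exist _ (e, g) (introT eqP h).

Lemma eiso_comp S T U (F F' : edge_set S T) (G G' : edge_set T U) :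
  F =~ F' -> G =~ G' -> F \oE G =~ F' \oE G'.
Proof.
case=> h [hb h1 h2 h3] [k [kb k1 k2 k3]].
have H (p : F \oE G) :
  erng F' (h (val p).1, k (val p).2).1 == esrc G' (h (val p).1, k (val p).2).2.
  by rewrite /= h2 k1; case: p.
pose f (p : F \oE G) : F' \oE G' := exist _ (h (val p).1, k (val p).2) (H p).
apply: (@eisoI _ _ _ _ f).
- move=> [[e g] p] [[e' g'] q] /(congr1 val) /= [/(bij_inj hb) E /(bij_inj kb) E'].
  by apply/val_inj => /=; rewrite E E'.
- move=> [[e g] p]; case: (hb) (kb) => h' hh' h'h [k' kk' k'k].
  have p' : erng F (h' e, k' g).1 == esrc G (h' e, k' g).2.
    by rewrite /= -h2 -k1 h'h k'k.
  by exists (exist _ (h' e, k' g) p'); apply/val_inj; rewrite /= h'h k'k.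
- by move=> e; rewrite /= h1.
- by move=> e; rewrite /= k2.
- move=> [[e g] p] [[e' g'] q]; rewrite /= /ecomp_le /=.
  by rewrite h3 k3 (inj_eq (bij_inj kb)).
Qed.

Lemma eiso_compl S T U (F F' : edge_set S T) (G : edge_set T U) :
  F =~ F' -> F \oE G =~ F' \oE G.
Proof. by move=> ?; apply: eiso_comp => //; apply: eiso_refl. Qed.

Lemma eiso_compr S T U (F : edge_set S T) (G G' : edge_set T U) :
  G =~ G' -> F \oE G =~ F \oE G'.
Proof. by move=> ?; apply: eiso_comp => //; apply: eiso_refl. Qed.

Lemma ecompA S T U W (F : edge_set S T) (G : edge_set T U) (H : edge_set U W) :
  F \oE (G \oE H) =~ F \oE G \oE H.
Proof.
have H1 (p : F \oE (G \oE H)) : erng F (val p).1 = esrc G (val (val p).2).1.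
  exact/eqP/(valP p).
have H2 (p : F \oE (G \oE H)) :
  erng (F \oE G) (epair (H1 p)) = esrc H (val (val p).2).2.
  by rewrite -(eqP (valP (val p).2)).
apply: (@eisoI _ _ _ _ (fun p => epair (H2 p))).
- move=> [[e [[g h] i]] j] [[e' [[g' h'] i']] j'] /(congr1 val) /= [] E1 E2 E3.
  subst; apply/val_inj => /=; congr (_, _); exact/val_inj.
- move=> [[[[e g] i] h] j]; have k : erng G g = esrc H h by apply/eqP.
  have l : erng F e = esrc (G \oE H) (epair k) by apply/eqP.
  exists (epair l).
  by apply/val_inj => /=; congr (_, _); apply/val_inj.
- by [].
- by [].
- move=> [[e [[g h] i]] j] [[e' [[g' h'] i']] j']; rewrite /= /ecomp_le /=.
  rewrite /ecomp_le /= -!val_eqE /= !xpair_eqE.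
  by case: (h == h'); case: (g == g'); rewrite /= ?andbT ?andbF ?orbF ?orbT.
Qed.

Lemma ecomp1l S T (F : edge_set S T) : id_edges S \oE F =~ F.
Proof.
apply: (@eisoI _ _ _ _ (fun p : id_edges S \oE F => (val p).2)).
- move=> [[v e] /= i] [[v' e'] /= j] /= E; subst e'; apply/val_inj => /=.
  by move: i j => /= /eqP -> /eqP ->.
- by move=> e; exists (@epair _ _ _ (id_edges S) F (esrc F e) e erefl).
- by move=> [[v e] i] /=; move/eqP: i.
- by [].
- move=> [[v e] i] [[v' e'] j]; rewrite /= /ecomp_le /=.
  by case/orP => /andP[] // /eqP ->; rewrite ele_refl.
Qed.

Lemma ecomp1r S T (F : edge_set S T) : F \oE id_edges T =~ F.
Proof.
apply: (@eisoI _ _ _ _ (fun p : F \oE id_edges T => (val p).1)).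
- move=> [[e v] /= i] [[e' v'] /= j] /= E; subst e'; apply/val_inj => /=.
  by move: i j => /= /eqP -> /eqP ->.
- by move=> e; exists (@epair _ _ _ F (id_edges T) e (erng F e) erefl).
- by [].
- by move=> [[e v] i] /=; move/eqP: i.
- move=> [[e v] i] [[e' v'] j]; rewrite /= /ecomp_le /=.
  by case/orP => /andP[] // /negPf ->.
Qed.

End IsoTheory.

(* [edg n] is the edge set from level [n] to level [n.+1], that is E_(n+1). *)
Record obd := Obd {
  vtx : nat -> finType;
  edg : forall n, edge_set (vtx n) (vtx n.+1);
  vtx0_card : #|vtx 0| = 1;
  vtx_gt0 : forall n, 0 < #|vtx n|;
  edg_gt0 : forall n, 0 < #|edg n|;
  edg_src : forall n (v : vtx n), exists e : edg n, esrc (edg n) e = v;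
  edg_rng : forall n (w : vtx n.+1), exists e : edg n, erng (edg n) e = w }.

Arguments edg : clear implicits.

(* [epaths V E k l] is E_(k,l) = E_(k+1) o ... o E_l, associated to the left and
   starting from the identity edges E_(k,k); it has no edges when l < k.  The
   recursion on [k] shifts the diagram, so as to avoid type casts. *)
Fixpoint epaths (V : nat -> finType) (E : forall n, edge_set (V n) (V n.+1))
    (k l : nat) {struct l} : edge_set (V k) (V l) :=
  match k, l with
  | 0, 0 => id_edges (V 0)
  | 0, l'.+1 => epaths E 0 l' \oE E l'
  | _.+1, 0 => empty_edges _ _
  | k'.+1, l'.+1 => @epaths (fun n => V n.+1) (fun n => E n.+1) k' l'
  end.

Definition epath (B : obd) (k l : nat) : edge_set (vtx B k) (vtx B l) :=
  epaths (edg B) k l.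

Section PathTheory.

Lemma epathsS (V : nat -> finType) (E : forall n, edge_set (V n) (V n.+1)) k l :
  k <= l -> epaths E k l.+1 = epaths E k l \oE E l.
Proof.
elim: k l V E => [|k IH] [|l] V E // kl.
exact: (IH l (fun n => V n.+1) (fun n => E n.+1)).
Qed.

Lemma epathsnn (V : nat -> finType) (E : forall n, edge_set (V n) (V n.+1)) k :
  epaths E k k = id_edges (V k).
Proof.
elim: k V E => [|k IH] V E //.
exact: (IH (fun n => V n.+1) (fun n => E n.+1)).
Qed.

Variable B : obd.

Lemma epath_cat k l m : k <= l -> l <= m ->
  epath B k l \oE epath B l m =~ epath B k m.
Proof.
move=> kl; elim: m => [|m IH] lm.
  move: lm kl; case: l => // _; case: k => // _.
  exact: ecomp1l.
move: lm; rewrite leq_eqVlt => /orP[/eqP E|].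
  by subst l; rewrite {2}/epath epathsnn; apply: ecomp1r.
rewrite ltnS => lm; rewrite /epath !epathsS ?(leq_trans kl) //.
apply: eiso_trans (ecompA _ _ _) _; apply: eiso_compl; exact: IH.
Qed.

End PathTheory.

Record premor (B C : obd) := Premor {
  pidx : nat -> nat;
  pedg : forall n, edge_set (vtx B n) (vtx C (pidx n));
  pidx0 : pidx 0 = 0;
  pidx_le : forall n, pidx n <= pidx n.+1;
  pidx_unbounded : forall N, exists n, N <= pidx n;
  pedg_gt0 : forall n, 0 < #|pedg n|;
  pedg_src : forall n (v : vtx B n), exists e : pedg n, esrc (pedg n) e = v;
  pedg_rng : forall n (w : vtx C (pidx n)),
    exists e : pedg n, erng (pedg n) e = w;
  pedg0_card : #|pedg 0| = 1;
  pedg_comm : forall n,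
    edg B n \oE pedg n.+1 =~ pedg n \oE epath C (pidx n) (pidx n.+1) }.

Arguments pidx {B C} _ _.
Arguments pedg {B C} _ _.

Definition pequiv (B C : obd) (f g : premor B C) : Prop :=
  exists n m : nat -> nat, 0 < n 0 /\ forall k,
    [/\ n k < m k, m k < n k.+1,
        pidx f (n k) < pidx g (m k), pidx g (m k) < pidx f (n k.+1) &
        epath B (n k) (m k) \oE pedg g (m k)
          =~ pedg f (n k) \oE epath C (pidx f (n k)) (pidx g (m k)) /\
        epath B (m k) (n k.+1) \oE pedg f (n k.+1)
          =~ pedg g (m k) \oE epath C (pidx g (m k)) (pidx f (n k.+1))].

Section PremorTheory.
Variables B C : obd.
Implicit Types f g h : premor B C.

Lemma pidx_mono f k l : k <= l -> pidx f k <= pidx f l.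
Proof.
move=> /subnK <-; elim: (l - k) => // d IH.
exact: leq_trans IH (pidx_le _ _).
Qed.

Lemma pidx_large f N : exists m, forall n, m <= n -> N <= pidx f n.
Proof.
have [m H] := pidx_unbounded f N; exists m => n mn.
exact: leq_trans H (pidx_mono _ mn).
Qed.

Lemma pedg_comm_path f k l : k <= l ->
  epath B k l \oE pedg f l =~ pedg f k \oE epath C (pidx f k) (pidx f l).
Proof.
elim: l => [|l IH] kl.
  move: kl; case: k => // _; rewrite /epath !epathsnn.
  by apply: eiso_trans (ecomp1l _) (eiso_sym (ecomp1r _)).
move: kl; rewrite leq_eqVlt => /orP[/eqP E|].
  subst k; rewrite /epath !epathsnn.
  by apply: eiso_trans (ecomp1l _) (eiso_sym (ecomp1r _)).
rewrite ltnS => kl; rewrite {1}/epath epathsS //.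
apply: eiso_trans (eiso_sym (ecompA _ _ _)) _.
apply: eiso_trans (eiso_compr _ (pedg_comm f l)) _.
apply: eiso_trans (ecompA _ _ _) _.
apply: eiso_trans (eiso_compl _ (IH kl)) _.
apply: eiso_trans (eiso_sym (ecompA _ _ _)) _.
by apply: eiso_compr; apply: epath_cat; apply: pidx_mono.
Qed.

(* Eventual equality of all levels; equivalent to [pequiv]. *)
Definition peventual f g : Prop := forall n, exists l,
  [/\ pidx f n <= l, pidx g n <= l &
   pedg f n \oE epath C (pidx f n) l =~ pedg g n \oE epath C (pidx g n) l].

Lemma peventual_up f g n : peventual f g -> exists L, forall l, L <= l ->
  [/\ pidx f n <= l, pidx g n <= l &
   pedg f n \oE epath C (pidx f n) l =~ pedg g n \oE epath C (pidx g n) l].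
Proof.
move=> /(_ n)[L [fL gL I]]; exists L => l Ll.
split; [exact: leq_trans fL Ll|exact: leq_trans gL Ll|].
apply: eiso_trans (eiso_compr _ (eiso_sym (epath_cat C fL Ll))) _.
apply: eiso_trans (ecompA _ _ _) _.
apply: eiso_trans (eiso_compl _ I) _.
apply: eiso_trans (eiso_sym (ecompA _ _ _)) _.
exact: eiso_compr (epath_cat C gL Ll).
Qed.

Lemma peventual_sym f g : peventual f g -> peventual g f.
Proof. by move=> H n; have [l [? ? /eiso_sym]] := H n; exists l. Qed.

Lemma pequiv_eventual f g : pequiv f g -> peventual f g.
Proof.
case=> n [m [_ H]] i.
have ni k : k <= n k.
  elim: k => // k IH; have [a b _ _ _] := H k.
  exact: leq_ltn_trans (leq_trans IH (ltnW a)) b.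
have [a b c d [I J]] := H i; have := ni i => ini.
exists (pidx g (m i)); split.
- exact: leq_trans (pidx_mono _ ini) (ltnW c).
- by apply: pidx_mono; apply: leq_trans ini (ltnW a).
have fi := pidx_mono f ini.
apply: eiso_trans (eiso_compr _ (eiso_sym (epath_cat C fi (ltnW c)))) _.
apply: eiso_trans (ecompA _ _ _) _.
apply: eiso_trans (eiso_compl _ (eiso_sym (pedg_comm_path f ini))) _.
apply: eiso_trans (eiso_sym (ecompA _ _ _)) _.
apply: eiso_trans (eiso_compr _ (eiso_sym I)) _.
apply: eiso_trans (ecompA _ _ _) _.
apply: eiso_trans (eiso_compl _ (epath_cat B ini (ltnW a))) _.
exact: pedg_comm_path (leq_trans ini (ltnW a)).
Qed.

Lemma peventual_next f g n : peventual f g -> exists m,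
  [/\ n < m, pidx f n < pidx g m &
   epath B n m \oE pedg g m =~ pedg f n \oE epath C (pidx f n) (pidx g m)].
Proof.
move=> H; have [L HL] := peventual_up n H.
have [M HM] := pidx_large g (maxn L (pidx f n).+1).
pose m := maxn M n.+1.
have nm : n < m by rewrite /m leq_maxr.
have gm := HM m (leq_maxl _ _).
exists m; split => //; first exact: leq_trans (leq_maxr _ _) gm.
have [a b I] := HL (pidx g m) (leq_trans (leq_maxl _ _) gm).
exact: eiso_trans (pedg_comm_path g (ltnW nm)) (eiso_sym I).
Qed.

Lemma eventual_pequiv f g : peventual f g -> pequiv f g.
Proof.
move=> H; have H' := peventual_sym H.
pose a n := projT1 (cid (peventual_next n H)).
pose b n := projT1 (cid (peventual_next n H')).
pose n k := iter k (b \o a) 1.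
exists n, (a \o n); split => // k /=.
have aP := projT2 (cid (peventual_next (n k) H)); rewrite -/(a _) in aP.
have bP := projT2 (cid (peventual_next (a (n k)) H')); rewrite -/(b _) in bP.
by case: aP => ? ? ?; case: bP => ? ? ?; split.
Qed.

Lemma pequivP f g : pequiv f g <-> peventual f g.
Proof. by split; [exact: pequiv_eventual|exact: eventual_pequiv]. Qed.

Lemma pequiv_refl f : pequiv f f.
Proof. by apply/pequivP => n; exists (pidx f n); split => //; exact: eiso_refl. Qed.

Lemma pequiv_sym f g : pequiv f g -> pequiv g f.
Proof. by move/pequivP/peventual_sym/pequivP. Qed.

Lemma pequiv_trans f g h : pequiv f g -> pequiv g h -> pequiv f h.
Proof.
move=> /pequivP fg /pequivP gh; apply/pequivP => n.
have [L HL] := peventual_up n fg; have [M HM] := peventual_up n gh.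
have [a b I] := HL _ (leq_maxl L M); have [c d J] := HM _ (leq_maxr L M).
by exists (maxn L M); split => //; apply: eiso_trans I J.
Qed.

End PremorTheory.

Section IdPremor.
Variable B : obd.

Fact idp_comm n :
  edg B n \oE epath B n.+1 n.+1 =~ epath B n n \oE epath B n n.+1.
Proof.
rewrite /epath !epathsnn epathsS // epathsnn.
apply: eiso_trans (ecomp1r _) _; apply: eiso_sym.
by apply: eiso_trans (ecomp1l _) (ecomp1l _).
Qed.

Fact idp_gt0 n : 0 < #|epath B n n|.
Proof. by rewrite /epath epathsnn; apply: vtx_gt0. Qed.

Fact idp_src n (v : vtx B n) :
  exists e : epath B n n, esrc (epath B n n) e = v.
Proof. by rewrite /epath epathsnn; exists v. Qed.

Fact idp_rng n (v : vtx B n) :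
  exists e : epath B n n, erng (epath B n n) e = v.
Proof. by rewrite /epath epathsnn; exists v. Qed.

Fact idp_card0 : #|epath B 0 0| = 1. Proof. exact: vtx0_card. Qed.

Definition idp : premor B B :=
  @Premor B B id (fun n => epath B n n) erefl (fun n => leqnSn n)
    (fun N => ex_intro _ N (leqnn N)) idp_gt0 idp_src idp_rng idp_card0 idp_comm.

End IdPremor.

Section CompPremor.
Variables (B C D : obd) (g : premor C D) (f : premor B C).

Let H n := pedg f n \oE pedg g (pidx f n).

Fact compp_src n (v : vtx B n) : exists e : H n, esrc (H n) e = v.
Proof.
have [e <-] := pedg_src f v; have [e' E] := pedg_src g (erng (pedg f n) e).
by exists (epair (esym E)).
Qed.

Fact compp_rng n (w : vtx D (pidx g (pidx f n))) :
  exists e : H n, erng (H n) e = w.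
Proof.
have [e <-] := pedg_rng w; have [e' E] := pedg_rng (esrc (pedg g (pidx f n)) e).
by exists (epair E).
Qed.

Fact compp_gt0 n : 0 < #|H n|.
Proof.
have /card_gt0P[v _] := vtx_gt0 B n; have [e _] := compp_src v.
by apply/card_gt0P; exists e.
Qed.

Fact compp_card0 : #|H 0| = 1.
Proof.
apply/eqP; rewrite eqn_leq compp_gt0 andbT.
rewrite /H [#|_|]card_sig; apply: leq_trans (max_card _) _.
rewrite card_prod pedg0_card mul1n.
by rewrite (pidx0 f) pedg0_card.
Qed.

Fact compp_unbounded N : exists n, N <= pidx g (pidx f n).
Proof.
have [m mN] := pidx_unbounded g N; have [n nm] := pidx_unbounded f m.
by exists n; apply: leq_trans mN (pidx_mono _ nm).
Qed.

Fact compp_comm n : edg B n \oE H n.+1 =~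
  H n \oE epath D (pidx g (pidx f n)) (pidx g (pidx f n.+1)).
Proof.
apply: eiso_trans (ecompA _ _ _) _.
apply: eiso_trans (eiso_compl _ (pedg_comm f n)) _.
apply: eiso_trans (eiso_sym (ecompA _ _ _)) _.
apply: eiso_trans (eiso_compr _ (pedg_comm_path g (pidx_le f n))) _.
exact: ecompA.
Qed.

Fact compp_idx0 : pidx g (pidx f 0) = 0. Proof. by rewrite !pidx0. Qed.

Definition compp : premor B D :=
  @Premor B D (fun n => pidx g (pidx f n)) H compp_idx0
    (fun n => pidx_mono g (pidx_le f n)) compp_unbounded
    compp_gt0 compp_src compp_rng compp_card0 compp_comm.

End CompPremor.

Lemma compp_pequiv (B C D : obd) (g g' : premor C D) (f f' : premor B C) :
  pequiv f f' -> pequiv g g' -> pequiv (compp g f) (compp g' f').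
Proof.
have left_ (h h' : premor B C) : pequiv h h' -> pequiv (compp g h) (compp g h').
  move=> /pequivP H; apply/pequivP => n /=; have [l [a b I]] := H n.
  exists (pidx g l); split; [exact: pidx_mono|exact: pidx_mono|].
  apply: eiso_trans (eiso_sym (ecompA _ _ _)) _.
  apply: eiso_trans (eiso_compr _ (eiso_sym (pedg_comm_path g a))) _.
  apply: eiso_trans (ecompA _ _ _) _.
  apply: eiso_trans (eiso_compl _ I) _.
  apply: eiso_trans (eiso_sym (ecompA _ _ _)) _.
  apply: eiso_trans (eiso_compr _ (pedg_comm_path g b)) _.
  exact: ecompA.
move=> ff' /pequivP gg'; apply: pequiv_trans (left_ _ _ ff') _.
apply/pequivP => n /=; have [l [a b I]] := gg' (pidx f' n).
exists l; split => //.
apply: eiso_trans (eiso_sym (ecompA _ _ _)) _.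
apply: eiso_trans (eiso_compr _ I) _.
exact: ecompA.
Qed.

(* The equivalence class of [f] is the predicate [pequiv f]. *)
Definition obd_hom (B C : obd) : Type :=
  {m : premor B C -> Prop | exists f, m = pequiv f}.

Definition pclass (B C : obd) (f : premor B C) : obd_hom B C :=
  exist _ (pequiv f) (ex_intro _ f erefl).

Lemma pclassP (B C : obd) (f g : premor B C) :
  pclass f = pclass g <-> pequiv f g.
Proof.
split=> [/(congr1 sval) /= ->|fg]; first exact: pequiv_refl.
apply: eq_exist; apply: funext => h; apply: propext; split.
  exact: pequiv_trans (pequiv_sym fg).
exact: pequiv_trans fg.
Qed.

Lemma obd_homP (B C : obd) (m : obd_hom B C) : exists f, m = pclass f.
Proof. by case: m => m [f E]; exists f; apply: eq_exist. Qed.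

Section ObdCategory.

Definition obd_cmp_pred (B C D : obd) (n : premor C D -> Prop)
    (m : premor B C -> Prop) (h : premor B D) : Prop :=
  exists g f, [/\ n g, m f & pequiv (compp g f) h].

Lemma obd_cmp_predE (B C D : obd) (g : premor C D) (f : premor B C) :
  obd_cmp_pred (pequiv g) (pequiv f) = pequiv (compp g f).
Proof.
apply: funext => h; apply: propext; split => [[g' [f' [gg' ff' H]]]|H].
  exact: pequiv_trans (compp_pequiv ff' gg') H.
by exists g, f; split => //; apply: pequiv_refl.
Qed.

Fact obd_cmp_subproof (B C D : obd) (n : obd_hom C D) (m : obd_hom B C) :
  exists h, obd_cmp_pred (sval n) (sval m) = pequiv h.
Proof.
have [g ->] := obd_homP n; have [f ->] := obd_homP m.
by exists (compp g f); apply: obd_cmp_predE.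
Qed.

Definition obd_cmp (B C D : obd) (n : obd_hom C D) (m : obd_hom B C) :
    obd_hom B D :=
  exist _ _ (obd_cmp_subproof n m).

Lemma obd_cmpE (B C D : obd) (g : premor C D) (f : premor B C) :
  obd_cmp (pclass g) (pclass f) = pclass (compp g f).
Proof. by apply: eq_exist; apply: obd_cmp_predE. Qed.

Fact obd_cmpA (A B C D : obd) (h : obd_hom C D) (g : obd_hom B C)
    (f : obd_hom A B) :
  obd_cmp h (obd_cmp g f) = obd_cmp (obd_cmp h g) f.
Proof.
have [{}h ->] := obd_homP h; have [{}g ->] := obd_homP g.
have [{}f ->] := obd_homP f; rewrite !obd_cmpE; apply/pclassP/pequivP => n.
exists (pidx h (pidx g (pidx f n))); split => //=.
apply: eiso_compl; exact: eiso_sym (ecompA _ _ _).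
Qed.

Fact obd_cmp1m (B C : obd) (f : obd_hom B C) : obd_cmp (pclass (idp C)) f = f.
Proof.
have [{}f ->] := obd_homP f; rewrite !obd_cmpE; apply/pclassP/pequivP => n.
exists (pidx f n); split => //=; apply: eiso_compl.
by rewrite /epath epathsnn; apply: ecomp1r.
Qed.

Fact obd_cmpm1 (B C : obd) (f : obd_hom B C) : obd_cmp f (pclass (idp B)) = f.
Proof.
have [{}f ->] := obd_homP f; rewrite !obd_cmpE; apply/pclassP/pequivP => n.
exists (pidx f n); split => //=; apply: eiso_compl.
by rewrite /epath epathsnn; apply: ecomp1l.
Qed.

Definition OBD : category :=
  @Category obd obd_hom (fun B => pclass (idp B)) obd_cmp
    obd_cmpA obd_cmp1m obd_cmpm1.

End ObdCategory.

Local Open Scope classical_set_scope.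

Definition metrizable (R : realType) (X : topologicalType) : Prop :=
  exists d : X -> X -> R,
    [/\ forall x y, (d x y = 0)%R <-> x = y,
        forall x y, d x y = d y x,
        forall x y z, (d x z <= d x y + d y z)%R &
        forall x, nbhs x =
          filter_from [set e : R | (0 < e)%R] (fun e => [set y | (d x y < e)%R])].

Definition homeomorphism (X : topologicalType) (phi : X -> X) : Prop :=
  continuous phi /\
  exists psi : X -> X, [/\ cancel phi psi, cancel psi phi & continuous psi].

Definition invariant_closed (X : topologicalType) (phi : X -> X) (M : set X) :=
  [/\ M !=set0, closed M & phi @` M = M].

Definition minimal_set (X : topologicalType) (phi : X -> X) (M : set X) : Prop :=
  invariant_closed phi M /\
  forall N, invariant_closed phi N -> N `<=` M -> N = M.

Record emsys (R : realType) := EmSys {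
  carrier :> topologicalType;
  shift : carrier -> carrier;
  base : carrier;
  carrier_metrizable : metrizable R carrier;
  carrier_compact : compact [set: carrier];
  carrier_disconnected : totally_disconnected [set: carrier];
  shift_homeo : homeomorphism shift;
  emsys_minimal : exists M : set carrier,
    [/\ minimal_set shift M, forall N, minimal_set shift N -> N = M & M base] }.

Arguments shift {R} _ _.
Arguments base {R} _.

(* A finite partition into towers is the finite set of its towers, each tower
   being the sequence (Z_1, ..., Z_J) of its cells, indexed from 0 by [nth]. *)
Section Partitions.
Variable X : topologicalType.
Implicit Types (P Q : {fset seq (set X)}) (S T : seq (set X)).

Definition cells P : set (set X) := [set A | exists2 T, T \in P & A \in T].

Definition top P : set X := [set x | exists2 T, T \in P & last set0 T x].

Definition bottom P : set X := [set x | exists2 T, T \in P & head set0 T x].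

Definition refined P Q : Prop :=
  forall B, cells Q B -> exists2 A, cells P A & B `<=` A.

Record is_KR (phi : X -> X) (x0 : X) P : Prop := IsKR {
  KR_height : forall T, T \in P -> 0 < size T;
  KR_cell : forall A, cells P A -> A !=set0 /\ clopen A;
  KR_cover : forall x, exists2 A, cells P A & A x;
  KR_disjoint : forall S T i j x, S \in P -> T \in P ->
    i < size S -> j < size T -> nth set0 S i x -> nth set0 T j x ->
    S = T /\ i = j;
  KR_shift : forall T j, T \in P -> j.+1 < size T ->
    phi @` nth set0 T j = nth set0 T j.+1;
  KR_base : top P x0;
  KR_top : phi @` top P = bottom P }.

(* [occurs S T k]: the tower [T] passes through all of [S] from level [k] on.
   The bound is needed because [nth] returns [set0] outside [T]. *)
Definition occurs S T (k : nat) : Prop :=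
  k + size S <= size T /\
  forall j, j < size S -> nth set0 T (k + j) `<=` nth set0 S j.

End Partitions.

Section OccurrenceEdges.
Variables (X : topologicalType) (A B : finType).
Variables (a : A -> seq (set X)) (b : B -> seq (set X)).
Hypothesis ab_inj : forall S S' T k,
  occurs (a S) (b T) k -> occurs (a S') (b T) k -> S = S'.

(* The triples (S, T, k); towers being non-empty, k < size T. *)
Definition occ_edge : finType :=
  {e : A * B * 'I_(\max_(T : B) size (b T)) |
     `[< occurs (a e.1.1) (b e.1.2) e.2 >]}.

Definition occ_le : rel occ_edge := fun e e' =>
  ((val e).1.2 == (val e').1.2) && ((val e).2 <= (val e').2).

Fact occ_refl : reflexive occ_le.
Proof. by move=> e; rewrite /occ_le eqxx leqnn. Qed.

Fact occ_anti : antisymmetric occ_le.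
Proof.
move=> [[[S T] k] h] [[[S' T'] k'] h']; rewrite /occ_le /=.
move=> /andP[/andP[/eqP E l] /andP[_ l']]; subst T'.
have {l l'} E : k = k' by apply/val_inj/eqP; rewrite eqn_leq l l'.
subst k'; apply/val_inj => /=; congr (_, _, _).
move/asboolP: h => /= h; move/asboolP: h' => /= h'.
exact: ab_inj h h'.
Qed.

Fact occ_trans : transitive occ_le.
Proof.
move=> e f g; rewrite /occ_le => /andP[/eqP -> l] /andP[-> l'].
exact: leq_trans l l'.
Qed.

Fact occ_comparable (e e' : occ_edge) :
  (occ_le e e' || occ_le e' e) = ((val e).1.2 == (val e').1.2).
Proof.
rewrite /occ_le [(val e').1.2 == _]eq_sym -andb_orr.
by case: leqP => /= [_|/ltnW ->]; rewrite ?andbT.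
Qed.

Definition occ_edges : edge_set A B :=
  @EdgeSet A B occ_edge (fun e => (val e).1.1) (fun e => (val e).1.2) occ_le
    occ_refl occ_anti occ_trans occ_comparable.

Lemma occ_edgeI S T k : occurs (a S) (b T) k -> 0 < size (a S) ->
  exists e : occ_edges, esrc occ_edges e = S /\ erng occ_edges e = T.
Proof.
move=> h S0; have kT : k < \max_(T : B) size (b T).
  apply: leq_trans (@leq_bigmax _ (fun T => size (b T)) T).
  by case: h => h _; apply: leq_trans h; rewrite -addn1 leq_add2l.
have h' : `[< occurs (a (S, T, Ordinal kT).1.1) (b (S, T, Ordinal kT).1.2)
   (S, T, Ordinal kT).2 >] by apply/asboolP.
by exists (exist _ (S, T, Ordinal kT) h').
Qed.

End OccurrenceEdges.

Section KRTheory.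
Variables (X : topologicalType) (phi : X -> X) (x0 : X).
Implicit Types (P Q : {fset seq (set X)}) (S T : seq (set X)).

Lemma KR_nth P T j : T \in P -> j < size T -> cells P (nth set0 T j).
Proof. by move=> TP jT; exists T => //; apply: mem_nth. Qed.

Lemma KR_at P : is_KR phi x0 P ->
  forall x, exists T j, [/\ T \in P, j < size T & nth set0 T j x].
Proof.
move=> hP x; have [A [T TP AT] Ax] := KR_cover hP x.
by exists T, (index A T); rewrite index_mem nth_index.
Qed.

Lemma KR_occurs P Q S T k : is_KR phi x0 P -> is_KR phi x0 Q -> refined P Q ->
  top Q `<=` top P -> S \in P -> T \in Q -> k < size T ->
  nth set0 T k `&` nth set0 S 0 !=set0 -> occurs S T k.
Proof.
move=> hP hQ PQ tops SP TQ kT [x [Tx Sx]].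
have S0 := KR_height hP SP.
have H j : j < size S -> k + j < size T /\ nth set0 T (k + j) `<=` nth set0 S j.
  elim: j => [_|j IH jS].
    rewrite addn0; split => // y Ty.
    have [A [S' S'P AS'] TA] := PQ _ (KR_nth TQ kT).
    have S'A : nth set0 S' (index A S') = A by rewrite nth_index.
    have [||E1 E2] := KR_disjoint hP S'P SP _ S0 _ Sx (i := index A S').
    - by rewrite index_mem.
    - by rewrite S'A; apply: TA.
    by move: (TA _ Ty); rewrite -S'A E1 -E2 E1 //.
  have [kj sub] := IH (ltnW jS).
  have [[y Ty] _] := KR_cell hQ (KR_nth TQ kj).
  have kj1 : (k + j).+1 < size T.
    rewrite ltn_neqAle kj andbT; apply/negP => /eqP E.
    have : top Q y by exists T => //; rewrite -nth_last -E.
    move=> /tops [S' S'P]; rewrite -nth_last => S'y.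
    have S'0 := KR_height hP S'P.
    have [|E1 E2] := KR_disjoint hP SP S'P (ltnW jS) _ (sub _ Ty) S'y.
      by rewrite prednK.
    by move: jS; rewrite E2 E1 prednK // ltnn.
  rewrite addnS; split => // z.
  rewrite -(KR_shift hQ TQ kj1) -(KR_shift hP SP jS).
  by case=> w Tw <-; exists w => //; apply: sub.
split; last by move=> j /H[].
have /H[] : (size S).-1 < size S by rewrite prednK.
by rewrite -ltnS -addnS prednK.
Qed.

Fact tower_edges_inj P Q (hP : is_KR phi x0 P) (hQ : is_KR phi x0 Q)
    (S S' : P) (T : Q) k :
  occurs (val S) (val T) k -> occurs (val S') (val T) k -> S = S'.
Proof.
move=> [h1 h2] [h3 h4]; have S0 := KR_height hP (valP S).
have S'0 := KR_height hP (valP S').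
have kT : k + 0 < size (val T) by apply: leq_trans h1; rewrite ltn_add2l.
have [[y Ty] _] := KR_cell hQ (KR_nth (valP T) kT).
apply/val_inj.
by have [] := KR_disjoint hP (valP S) (valP S') S0 S'0 (h2 _ S0 _ Ty) (h4 _ S'0 _ Ty).
Qed.

(* E(P, Q) *)
Definition tower_edges P Q (hP : is_KR phi x0 P) (hQ : is_KR phi x0 Q) :
    edge_set P Q :=
  occ_edges (tower_edges_inj hP hQ).

End KRTheory.

Record sds (R : realType) := Sds {
  sys :> emsys R;
  KR : nat -> {fset seq (set sys)};
  KR_isKR : forall n, is_KR (shift sys) (base sys) (KR n);
  KR_0 : KR 0 = [fset [:: [set: sys]]]%fset;
  KR_refined : forall n, refined (KR n) (KR n.+1);
  KR_top_decr : forall n, 0 < n -> top (KR n.+1) `<=` top (KR n);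
  KR_top_cap : \bigcap_(n in [set n | 0 < n]) top (KR n) = [set base sys];
  KR_basis : basis (\bigcup_n cells (KR n)) }.

Arguments KR {R} _ _.

Record sds_map (R : realType) (X Y : sds R) := SdsMap {
  smap :> X -> Y;
  smap_continuous : continuous smap;
  smap_shift : forall x, smap (shift X x) = shift Y (smap x);
  smap_base : smap (base X) = base Y }.

Section SdsCategory.
Variable R : realType.

(* Morphisms are onto.  This is what makes the inverse image of a
   Kakutani-Rokhlin partition one (its cells have to be non-empty), and without
   it there is no functor to OBD: when X is a point and Y the one-point
   compactification of the integers with its shift, the constant map X -> Y with
   value the fixed point is continuous, equivariant and pointed, but there is no
   premorphism between the diagrams; see also [represents_surj] below. *)
Definition sds_hom (X Y : sds R) : Type :=
  {a : sds_map X Y | forall y, exists x, a x = y}.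

Lemma sds_homP (X Y : sds R) (a b : sds_hom X Y) :
  (forall x, sval a x = sval b x) -> a = b.
Proof.
case: a b => [[a a1 a2 a3] a4] [[b b1 b2 b3] b4] /= E.
have {}E : a = b by apply: funext.
subst b; apply: eq_exist.
by congr (SdsMap _ _ _); apply: Prop_irrelevance.
Qed.

Definition sds_idm (X : sds R) : sds_hom X X :=
  exist _ (@SdsMap R X X id (fun _ => cvg_id) (fun _ => erefl) erefl)
    (fun y => ex_intro _ y erefl).

Section Comp.
Variables (X Y Z : sds R) (b : sds_hom Y Z) (a : sds_hom X Y).
Let f (x : X) : Z := sval b (sval a x).
Fact sds_cmp_continuous : continuous f.
Proof.
move=> x; apply: continuous_comp; exact: smap_continuous.
Qed.
Fact sds_cmp_shift x : f (shift X x) = shift Z (f x).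
Proof. by rewrite /f !smap_shift. Qed.
Fact sds_cmp_base : f (base X) = base Z.
Proof. by rewrite /f !smap_base. Qed.
Fact sds_cmp_surj z : exists x, f x = z.
Proof.
by have [y <-] := svalP b z; have [x <-] := svalP a y; exists x.
Qed.
Definition sds_cmp : sds_hom X Z :=
  exist _ (SdsMap sds_cmp_continuous sds_cmp_shift sds_cmp_base) sds_cmp_surj.
End Comp.

Definition SDS : category.
Proof.
by refine (@Category (sds R) sds_hom sds_idm sds_cmp _ _ _) => *;
  apply: sds_homP.
Defined.

End SdsCategory.

Section DiagramOfSystem.
Variables (R : realType) (X : sds R).

Lemma KR_top_sub n : top (KR X n.+1) `<=` top (KR X n).
Proof.
case: n => [|n]; last exact: KR_top_decr.
by move=> x _; exists [:: setT] => //; rewrite KR_0 inE.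
Qed.

Definition sds_vtx (n : nat) : finType := KR X n.

Definition sds_edg (n : nat) : edge_set (sds_vtx n) (sds_vtx n.+1) :=
  tower_edges (KR_isKR X n) (KR_isKR X n.+1).

Fact sds_vtx0 : #|sds_vtx 0| = 1.
Proof. by rewrite /sds_vtx -cardfE KR_0 cardfs1. Qed.

Fact sds_vtx_gt0 n : 0 < #|sds_vtx n|.
Proof.
have [T [j [TP _ _]]] := KR_at (KR_isKR X n) (base X).
by apply/card_gt0P; exists [` TP]%fset.
Qed.

Fact sds_src n (v : sds_vtx n) : exists e : sds_edg n, esrc (sds_edg n) e = v.
Proof.
have v0 := KR_height (KR_isKR X n) (valP v).
have [[x vx] _] := KR_cell (KR_isKR X n) (KR_nth (valP v) v0).
have [T [k [TP kT Tx]]] := KR_at (KR_isKR X n.+1) x.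
have h : occurs (val v) (val [` TP]%fset) k.
  apply: (KR_occurs (KR_isKR X n) (KR_isKR X n.+1)) => //.
  - exact: KR_refined.
  - exact: KR_top_sub.
  - exact: valP.
  - by exists x.
by have [e [? _]] := occ_edgeI (tower_edges_inj (KR_isKR X n) (KR_isKR X n.+1)) h v0; exists e.
Qed.

Fact sds_rng n (w : sds_vtx n.+1) :
  exists e : sds_edg n, erng (sds_edg n) e = w.
Proof.
have w0 := KR_height (KR_isKR X n.+1) (valP w).
have [[x wx] _] := KR_cell (KR_isKR X n.+1) (KR_nth (valP w) w0).
have : bottom (KR X n.+1) x by exists (val w); [exact: valP|rewrite -nth0].
rewrite -(KR_top (KR_isKR X n.+1)) => -[y /KR_top_sub yt yx].
have : (shift X @` top (KR X n)) x by exists y.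
rewrite (KR_top (KR_isKR X n)) => -[S SP Sx].
have S0 := KR_height (KR_isKR X n) SP.
have h : occurs (val [` SP]%fset) (val w) 0.
  apply: (KR_occurs (KR_isKR X n) (KR_isKR X n.+1)) => //.
  - exact: KR_refined.
  - exact: KR_top_sub.
  - exact: valP.
  - by exists x; split => //; rewrite nth0.
by have [e [_ ?]] := occ_edgeI (tower_edges_inj (KR_isKR X n) (KR_isKR X n.+1)) h S0; exists e.
Qed.

Fact sds_edg_gt0 n : 0 < #|sds_edg n|.
Proof.
have /card_gt0P[v _] := sds_vtx_gt0 n; have [e _] := sds_src v.
by apply/card_gt0P; exists e.
Qed.

Definition sds_diagram : OBD :=
  @Obd sds_vtx sds_edg sds_vtx0 sds_vtx_gt0 sds_edg_gt0 sds_src sds_rng.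

End DiagramOfSystem.

Section PremorOfMap.
Variables (R : realType) (X Y : sds R) (a : sds_map X Y).

Definition preim_tower (S : seq (set Y)) : seq (set X) := map (preimage a) S.

Definition preim_KR (n : nat) : {fset seq (set X)} :=
  [fset preim_tower S | S in KR Y n]%fset.

Fact map_edges_inj n l (S S' : KR Y n) (T : KR X l) k :
  occurs (preim_tower (val S)) (val T) k ->
  occurs (preim_tower (val S')) (val T) k -> S = S'.
Proof.
move=> [h1 h2] [_ h4]; have hY := KR_isKR Y n.
have S0 := KR_height hY (valP S); have S'0 := KR_height hY (valP S').
move: h1 h2 h4; rewrite /preim_tower !size_map => h1 h2 h4.
have kT : k + 0 < size (val T) by apply: leq_trans h1; rewrite ltn_add2l.
have [[y Ty] _] := KR_cell (KR_isKR X l) (KR_nth (valP T) kT).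
have := h2 _ S0 _ Ty; have := h4 _ S'0 _ Ty.
rewrite !(nth_map set0) // => y1 y2; apply/val_inj.
by have [] := KR_disjoint hY (valP S) (valP S') S0 S'0 y2 y1.
Qed.

Definition map_edges (n l : nat) : edge_set (KR Y n) (KR X l) :=
  occ_edges (@map_edges_inj n l).

(* [f] is built from [a] for the choice [pidx f] of the sequence (f_n). *)
Definition represents (f : premor (sds_diagram Y) (sds_diagram X)) : Prop :=
  forall n, [/\ refined (preim_KR n) (KR X (pidx f n)),
    top (KR X (pidx f n)) `<=` top (preim_KR n) &
    pedg f n = map_edges n (pidx f n)].

End PremorOfMap.

Lemma metrizable_hausdorff (R : realType) (X : topologicalType) :
  metrizable R X -> hausdorff_space X.
Proof.
case=> d [d0 dC dT dN] p q pq; apply: contrapT => npq.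
have d_pos : (0 < d p q)%R.
  have d_ge0 : (0 <= d p q)%R.
    have := dT p q p; rewrite (dC q p) (d0 p p).2 //.
    by rewrite -mulr2n pmulrn_lge0.
  by rewrite lt_neqAle d_ge0 andbT eq_sym; apply/eqP => /d0.
have r_pos : (0 < d p q / 2)%R by rewrite divr_gt0.
have B x : nbhs x [set y | (d x y < d p q / 2)%R].
  by rewrite dN; exists (d p q / 2)%R.
have [z [/= pz qz]] := pq _ _ (B p) (B q).
have := dT p z q; rewrite leNgt => /negP; apply.
by rewrite (dC z q) [X in (_ < X)%R]splitr ltrD.
Qed.

(* The formula defining P(a) yields a premorphism only if [a] is onto: if a cell
   of Y misses the image of [a], its tower has an empty preimage and is not the
   source of any edge. *)
Lemma represents_surj (R : realType) (X Y : sds R) (a : sds_map X Y)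
    (f : premor (sds_diagram Y) (sds_diagram X)) :
  represents a f -> forall y, exists x, a x = y.
Proof.
move=> fa y.
have cl : closed (range a).
  apply: compact_closed; first exact: metrizable_hausdorff (carrier_metrizable Y).
  apply: continuous_compact; last exact: carrier_compact.
  by apply: continuous_subspaceT; apply: smap_continuous.
suff [x _ xy] : range a y by exists x.
apply: cl => U /((KR_basis Y).2 y)[A [[n _ [S SP AS]] Ay] AU].
have [_ _ E] := fa n.
have [[[[S' T] k] h]] : exists e : map_edges a n (pidx f n),
    esrc (map_edges a n (pidx f n)) e = [` SP]%fset.
  by rewrite -E; apply: pedg_src.
move=> /= ES; subst S'; move/asboolP: h => /= -[h1 h2].
have jS : index A S < size (preim_tower a S) by rewrite size_map index_mem.
have kT : k + index A S < size (val T).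
  by apply: leq_trans h1; rewrite ltn_add2l.
have [[x Tx] _] := KR_cell (KR_isKR X _) (KR_nth (valP T) kT).
have := h2 _ jS _ Tx; rewrite (nth_map set0) ?index_mem // nth_index // => Ax.
by exists (a x); split; [exists x|apply: AU].
Qed.

(* The value of [P] at [a] is the class of the premorphism built from [a], for
   every choice of the sequence (f_n), and such a choice exists. *)
Definition is_P (R : realType)
    (P : forall X Y : SDS R, hom X Y -> hom (sds_diagram Y) (sds_diagram X)) :=
  forall (X Y : SDS R) (a : hom X Y),
    (exists f, represents (sval a) f) /\
    (forall f, represents (sval a) f -> P X Y a = pclass f).

(* Main.v *)
Require Import Defs.
From mathcomp Require Import all_boot reals.
From mathcomp Require Import finmap boolp classical_sets.
From mathcomp Require Import topology_structure compact separation_axioms.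

(* Give each edge of E(P, Q) the height of its source tower as a weight.  The
   towers of P occurring in a tower T of Q tile T, so the position k of an edge
   (S, T, k) is the sum of the weights of the smaller edges with range T: it is
   an invariant of ordered edge sets ([offset]).

   Faithfulness: if a and b have equivalent premorphisms, then at some level of X
   the edge sets of a and b agree, offsets included, so a and b send every point
   to the same cell at every level of Y.

   Fullness: comparing paths from the root, for a premorphism f = (F_n) the
   weights of the edges of F_n with range T add up to the height of T.  The
   offsets in F_n therefore assign to every x a cell c_n(x) of Y.  The relations
   between the F_n make c_n(x) decreasing in n, and the map sought sends x to the
   unique point of the intersection.  It commutes with the shifts because c_n
   can fail to do so only by jumping from the top to the bottom of level n, and
   the tops shrink to the base point.  Its edge sets have the offsets of the F_n,
   hence are isomorphic to them. *)

Set Implicit Arguments.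
Unset Strict Implicit.
Unset Printing Implicit Defensive.

(** * Offsets in ordered edge sets *)

(** Both sides count the pairs of an edge and a point of its interval [[k e], [k e + h e]); the
    hypothesis keeps these intervals inside [0, [M]). *)
Lemma double_count (I : finType) (D : pred I) (k h : I -> nat) M :
  (forall e, D e -> k e + h e <= M) ->
  \sum_(e | D e) h e =
  \sum_(i < M) #|[pred e | D e && (k e <= i < k e + h e)]|.
Proof.
move=> kh; under [RHS]eq_bigr => i _ do rewrite -sum1_card.
rewrite (exchange_big_dep D) /=; last by move=> i e _ /andP[].
apply: eq_bigr => e De; rewrite -[LHS](addKn (k e)) -[LHS]muln1.
rewrite -sum_nat_const_nat (big_nat_widenl _ _ _ _ _ (leq0n _)).
rewrite (big_nat_widen _ _ _ _ _ (kh e De)) big_mkord.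
by apply: eq_bigl => i; rewrite inE De.
Qed.

Section Offsets.
Variables (S T : finType) (F : edge_set S T) (h : S -> nat).

Definition elt (e e' : F) := (e != e') && ele F e e'.

Definition offset (e : F) := \sum_(e' | elt e' e) h (esrc F e').

Definition height (t : T) := \sum_(e | erng F e == t) h (esrc F e).

Lemma elt_rng e e' : elt e e' -> erng F e = erng F e'.
Proof. by case/andP=> _ /ele_rng. Qed.

Lemma elt_trans : transitive elt.
Proof.
move=> f e g /andP[ef le] /andP[fg lf]; rewrite /elt (ele_trans le lf) andbT.
apply/eqP => E; subst g; case/eqP: ef; apply: (@ele_anti _ _ F).
by rewrite le.
Qed.

Lemma elt_total e e' : erng F e = erng F e' -> [\/ e = e', elt e e' | elt e' e].
Proof.
rewrite /elt eq_sym; have [->|ne] := eqVneq e' e; first by constructor 1.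
by case/ele_total/orP => ->; [constructor 2|constructor 3].
Qed.

Lemma sum_below (D : pred F) e :
  D e -> (forall e', elt e' e -> D e') ->
  offset e + h (esrc F e) <= \sum_(e' | D e') h (esrc F e').
Proof.
move=> De sub; rewrite [leqRHS](bigD1 e) //= addnC leq_add2l /offset.
rewrite big_mkcond [leqRHS]big_mkcond; apply: leq_sum => f _.
by case: ifP => // fe; rewrite (sub _ fe); case/andP: fe => ->.
Qed.

Lemma offset_elt e e' : elt e e' -> offset e + h (esrc F e) <= offset e'.
Proof. by move=> ee'; apply: sum_below => // f /elt_trans; apply. Qed.

Lemma offset_height e : offset e + h (esrc F e) <= height (erng F e).
Proof. by apply: sum_below => // f /elt_rng ->. Qed.

(* An edge [e] is seen as the interval of length [h (esrc F e)] starting at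
   [k e]. *)
Definition spaced (k : F -> nat) :=
  forall e e', elt e e' -> k e + h (esrc F e) <= k e'.

Definition covers (k : F -> nat) e i := k e <= i < k e + h (esrc F e).

(** Each fibre is totally ordered, so the intervals of distinct edges over one vertex are disjoint:
    a point determines the edge and the place inside it. *)
Lemma covers_inj k e e' i j : spaced k -> erng F e = erng F e' ->
  i < h (esrc F e) -> j < h (esrc F e') -> k e + i = k e' + j ->
  e = e' /\ i = j.
Proof.
move=> sp r ie je E; have [ee'|/sp l|/sp l] := elt_total r.
- by subst e'; move/addnI: E.
- by move: ie; rewrite -(ltn_add2l (k e)) E ltnNge (leq_trans l) ?leq_addr.
- by move: je; rewrite -(ltn_add2l (k e')) -E ltnNge (leq_trans l) ?leq_addr.
Qed.

Lemma covers_card k (D : pred F) i : spaced k ->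
  (forall e e', D e -> D e' -> erng F e = erng F e') ->
  #|[pred e | D e && covers k e i]| <= 1.
Proof.
move=> sp DT; apply/card_le1_eqP => e e'; rewrite !inE.
move=> /andP[De /andP[l1 l2]] /andP[De' /andP[l3 l4]].
have [] // := @covers_inj k e' e (i - k e') (i - k e) sp (DT _ _ De' De).
- by rewrite ltn_subLR.
- by rewrite ltn_subLR.
- by rewrite !subnKC.
Qed.

(** In [double_count] every point below [M] is counted exactly once: at most once by spacing, at
    least once by covering. *)
Lemma tiling_sum k (D : pred F) M : spaced k ->
  (forall e e', D e -> D e' -> erng F e = erng F e') ->
  (forall e, D e -> k e + h (esrc F e) <= M) ->
  (forall i, i < M -> exists2 e, D e & covers k e i) ->
  \sum_(e | D e) h (esrc F e) = M.
Proof.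
move=> sp DT DM cov; rewrite (double_count DM) -[RHS]card_ord -sum1_card.
apply: eq_big => // i _; apply/eqP.
rewrite eqn_leq covers_card //=; have [e De ei] := cov i (ltn_ord i).
by apply/card_gt0P; exists e; rewrite inE De.
Qed.

(** A point below [k e] is covered by an edge of the same fibre, which is neither [e] nor a larger
    edge, since those start later. So the edges below [e] tile [0, [k e]), and [tiling_sum] gives
    their total weight. *)
Lemma tiling_offset k (N : T -> nat) : spaced k ->
  (forall e, k e + h (esrc F e) <= N (erng F e)) ->
  (forall t i, i < N t -> exists2 e, erng F e = t & covers k e i) ->
  (forall e, 0 < h (esrc F e)) ->
  (forall e, offset e = k e) /\ (forall t, height t = N t).
Proof.
move=> sp kN cov h0; split=> [e|t]; apply: (tiling_sum sp) => //.
- by move=> e1 e2 /elt_rng -> /elt_rng ->.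
- by move=> e'; apply: sp.
- move=> i ie.
  have [e' r /andP[l1 l2]] := cov (erng F e) i
    (leq_trans ie (leq_trans (leq_addr _ _) (kN e))).
  exists e'; last by rewrite /covers l1.
  have [E|//|/sp l] := elt_total r; first by move: ie; rewrite -E ltnNge l1.
  by move: ie; rewrite ltnNge (leq_trans _ l1) // (leq_trans _ l) // leq_addr.
- by move=> e1 e2 /eqP -> /eqP ->.
- by move=> e /eqP <-.
- by move=> i /cov[e /eqP r ei]; exists e.
Qed.

(** The offset intervals over [t] are disjoint, lie below [height t] and have total length
    [height t]; a missed point would leave room for one less. *)
Lemma offset_cover t i : i < height t ->
  exists2 e, erng F e = t & covers offset e i.
Proof.
move=> it; apply: contrapT => nex.
pose D e := erng F e == t; have sp : spaced offset by move=> *; apply: offset_elt.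
have /double_count : forall e, D e -> offset e + h (esrc F e) <= height t.
  by move=> e /eqP <-; apply: offset_height.
apply/eqP; rewrite neq_ltn; apply/orP; right.
rewrite -/(height t) (bigD1 (Ordinal it)) //= [X in X + _]eq_card0 ?add0n; last first.
  move=> e; rewrite !inE; apply/negP => /andP[/eqP r c].
  by apply: nex; exists e.
apply: (@leq_ltn_trans (\sum_(j < height t | j != Ordinal it) 1)).
  apply: leq_sum => j _; apply: covers_card => //.
  by move=> e e' /eqP -> /eqP ->.
rewrite sum1_card cardC1 card_ord prednK ?leqnn //; exact: leq_ltn_trans it.
Qed.

End Offsets.

Lemma spaced_offset S T (F : edge_set S T) h : spaced h (@offset S T F h).
Proof. by move=> e e'; apply: offset_elt. Qed.

Section OffsetIso.
Variables (S T : finType) (F F' : edge_set S T) (h : S -> nat) (f : F -> F').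
Hypotheses (fbij : bijective f) (fs : forall e, esrc F' (f e) = esrc F e)
  (fr : forall e, erng F' (f e) = erng F e)
  (fle : forall e e', ele F' (f e) (f e') = ele F e e').

Lemma offset_iso e : offset h (f e) = offset h e.
Proof.
rewrite /offset (reindex f) /=; last exact: onW_bij.
apply: eq_big => e'; last by rewrite fs.
by rewrite /elt fle (inj_eq (bij_inj fbij)).
Qed.

Lemma height_iso t : height F' h t = height F h t.
Proof.
rewrite /height (reindex f) /=; last exact: onW_bij.
by apply: eq_big => e'; rewrite ?fr ?fs.
Qed.

End OffsetIso.

Lemma eiso_height S T (F F' : edge_set S T) h t :
  F =~ F' -> height F h t = height F' h t.
Proof. by case=> f [fb fs fr _]; rewrite (height_iso h fb fs fr). Qed.

(** * Offsets and heights in composite edge sets *)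

Section OffsetComp.
Variables (S T U : finType) (F : edge_set S T) (G : edge_set T U).
Variable h : S -> nat.

(** The composite compares second components first. Below (e, g) lie all pairs over some g' below g,
    whose weights add up to [height F h] at the source of g', and the pairs (e', g) with e' below
    e. *)
Lemma offset_comp (p : F \oE G) :
  offset h p = offset (height F h) (val p).2 + offset h (val p).1.
Proof.
case: p => [[e g] eg] /=; move/eqP: (eg) => /= Eeg.
rewrite /offset /height; set D := [pred x : F * G | erng F x.1 == esrc G x.2].
(* [Q] extends the strict order below the pair to the whole product, which turns the sum over the
   subtype into a double sum. *)
pose Q (x : F * G) := elt x.2 g || (x.2 == g) && elt x.1 e.
rewrite (eq_bigl (fun p : F \oE G => Q (val p))); last first.
  move=> [[e' g'] eg'] /=; rewrite /elt /= /ecomp_le /= -val_eqE /= xpair_eqE.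
  rewrite /Q /elt /=; have [->|_] /= := eqVneq g' g; last by rewrite andbF orbF.
  by rewrite andbT.
rewrite -(big_sub_cond D Q (fun x => h (esrc F x.1))).
rewrite (bigID (fun x : F * G => elt x.2 g)) /=; congr (_ + _).
  rewrite (exchange_big_dep xpredT) //= pair_big_dep; apply: eq_bigl => -[e' g'].
  by rewrite !inE /Q /=; case: (elt g' g); rewrite ?andbF ?andbT.
transitivity (\sum_(e' | elt e' e) \sum_(g' | g' == g) h (esrc F e')).
  rewrite pair_big_dep; apply: eq_bigl => -[e' g'] /=.
  rewrite !inE /Q /=; have [->|_] := eqVneq g' g; last first.
    by case: (elt g' g); rewrite /= !andbF.
  rewrite [elt g g]/elt eqxx /= !andbT andbC.
  by case: (boolP (elt e' e)) => // /elt_rng ->; rewrite eg.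
by apply: eq_bigr => e' _; rewrite big_pred1_eq.
Qed.

Lemma height_comp u : height (F \oE G) h u = height G (height F h) u.
Proof.
rewrite /height; set D := [pred x : F * G | erng F x.1 == esrc G x.2].
rewrite -(big_sub_cond D (fun x => erng G x.2 == u) (fun x => h (esrc F x.1))).
rewrite (exchange_big_dep xpredT) //= pair_big_dep.
by apply: eq_bigl => -[e g]; rewrite !inE andbC.
Qed.

End OffsetComp.

(** * Occurrences of towers *)

Local Open Scope classical_set_scope.

Section Occurrences.
Variables (X : topologicalType) (A B : finType).
Variables (a : A -> seq (set X)) (b : B -> seq (set X)).
Hypothesis ab_inj : forall S S' T k,
  occurs (a S) (b T) k -> occurs (a S') (b T) k -> S = S'.
Hypothesis a_gt0 : forall S, 0 < size (a S).

Definition occ_pos (e : occ_edge a b) : nat := (val e).2.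

Lemma occ_posP (e : occ_edges ab_inj) :
  occurs (a (esrc (occ_edges ab_inj) e)) (b (erng (occ_edges ab_inj) e))
    (occ_pos e).
Proof. exact/asboolP/(valP e). Qed.

Lemma occ_leE (e e' : occ_edges ab_inj) : ele (occ_edges ab_inj) e e' =
  (erng (occ_edges ab_inj) e == erng (occ_edges ab_inj) e') &&
  (occ_pos e <= occ_pos e').
Proof. by []. Qed.

Lemma occ_pos_inj (e e' : occ_edges ab_inj) :
  erng (occ_edges ab_inj) e = erng (occ_edges ab_inj) e' ->
  occ_pos e = occ_pos e' -> e = e'.
Proof.
move=> r p; apply: (@ele_anti _ _ (occ_edges ab_inj)).
by rewrite !occ_leE r p eqxx leqnn.
Qed.

Lemma occ_edge_ex S T k : occurs (a S) (b T) k ->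
  exists e : occ_edges ab_inj, [/\ esrc (occ_edges ab_inj) e = S,
    erng (occ_edges ab_inj) e = T & occ_pos e = k].
Proof.
move=> h; have kT : k < \max_(T : B) size (b T).
  apply: leq_trans (@leq_bigmax _ (fun T => size (b T)) T).
  by case: h => h _; apply: leq_trans h; rewrite -addn1 leq_add2l.
have h' : `[< occurs (a (S, T, Ordinal kT).1.1) (b (S, T, Ordinal kT).1.2)
   (S, T, Ordinal kT).2 >] by apply/asboolP.
by exists (exist _ (S, T, Ordinal kT) h').
Qed.

(** The criterion behind the isomorphisms for compositions, for paths and for the limit map: the
    hypotheses on the positions [p] yield in turn the map, its surjectivity, its injectivity and its
    monotonicity. *)
Lemma eiso_occ (F : edge_set A B) (p : F -> nat) :
  (forall e, occurs (a (esrc F e)) (b (erng F e)) (p e)) ->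
  (forall S T k, occurs (a S) (b T) k ->
    exists e, [/\ esrc F e = S, erng F e = T & p e = k]) ->
  (forall e e', erng F e = erng F e' -> p e = p e' -> e = e') ->
  (forall e e', ele F e e' -> p e <= p e') ->
  F =~ occ_edges ab_inj.
Proof.
move=> pocc pex pinj ple.
pose f e := projT1 (cid (occ_edge_ex (pocc e))).
have fP e : [/\ esrc (occ_edges ab_inj) (f e) = esrc F e,
  erng (occ_edges ab_inj) (f e) = erng F e & occ_pos (f e) = p e].
  exact: (projT2 (cid (occ_edge_ex (pocc e)))).
apply: (@eisoI _ _ _ _ f) => [e e' E|y|e|e|e e' ee'].
- have [_ r k] := fP e; have [_ r' k'] := fP e'.
  by apply: pinj; rewrite -?r -?k -?r' -?k' E.
- have [e [s r k]] := pex _ _ _ (occ_posP y); exists e.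
  by have [_ r' k'] := fP e; apply: occ_pos_inj; rewrite ?r' ?k'.
- by have [] := fP e.
- by have [] := fP e.
- have [_ r k] := fP e; have [_ r' k'] := fP e'.
  by rewrite occ_leE k k' (ple _ _ ee') r r' (ele_rng ee') eqxx.
Qed.

End Occurrences.

(** Only the set of occurring triples matters, so the towers may live in different spaces; this
    serves to replace towers by their inverse images. *)
Lemma eiso_occ_occ (X X' : topologicalType) (A B : finType)
    (a : A -> seq (set X)) (b : B -> seq (set X))
    (a' : A -> seq (set X')) (b' : B -> seq (set X')) ab_inj ab_inj' :
  (forall S, 0 < size (a S)) -> (forall S, 0 < size (a' S)) ->
  (forall S T k, occurs (a S) (b T) k <-> occurs (a' S) (b' T) k) ->
  @occ_edges X A B a b ab_inj =~ @occ_edges X' A B a' b' ab_inj'.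
Proof.
move=> a0 a'0 E; apply: (@eiso_occ _ _ _ _ _ _ a'0 (occ_edges ab_inj)
  (@occ_pos _ _ _ a b)).
- by move=> e; apply/E/occ_posP.
- by move=> S T k /E/(occ_edge_ex ab_inj a0).
- exact: occ_pos_inj.
- by move=> e e' /= /andP[].
Qed.

(** * Composition and tiling of occurrences between Kakutani-Rokhlin partitions *)

Section KRPartitions.
Variables (X : topologicalType) (phi : X -> X) (x0 : X).
Hypothesis phi_inj : injective phi.
Implicit Types (P Q R : {fset seq (set X)}) (S T U : seq (set X)).

Lemma occurs_trans S U T i j :
  occurs S U i -> occurs U T j -> occurs S T (j + i).
Proof.
move=> [iU SU] [jT UT]; split=> [|m mS].
  by rewrite -addnA; apply: leq_trans jT; rewrite leq_add2l.
rewrite -addnA; apply: subset_trans (SU _ mS); apply: UT.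
by apply: leq_trans iU; rewrite ltn_add2l.
Qed.

(** A level of [T] is a non-empty set, hence lies in only one of the disjoint cells of [P]. *)
Lemma occurs_uniq P Q S S' T i i' j j' :
  is_KR phi x0 P -> is_KR phi x0 Q -> S \in P -> S' \in P -> T \in Q ->
  occurs S T j -> occurs S' T j' -> i < size S -> i' < size S' ->
  j + i = j' + i' -> S = S' /\ i = i'.
Proof.
move=> hP hQ SP SP' TQ [jT ST] [jT' ST'] iS iS' E.
have kT : j + i < size T by apply: leq_trans jT; rewrite ltn_add2l.
have [[y Ty] _] := KR_cell hQ (KR_nth TQ kT).
apply: (KR_disjoint hP SP SP' iS iS' (ST _ iS _ Ty)).
by apply: (ST' _ iS'); rewrite -E.
Qed.

(** Pulling the common point back by [phi] reduces to the case m = 0. The bottom of [T] is not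
    reached first: bottoms are images of tops, so a point in the bottom of [Q] lies at level 0 for
    [P]. *)
Lemma KR_occurs_at P Q U T m k : is_KR phi x0 P -> is_KR phi x0 Q ->
  refined P Q -> top Q `<=` top P -> U \in P -> T \in Q ->
  m < size U -> k < size T -> nth set0 T k `&` nth set0 U m !=set0 ->
  m <= k /\ occurs U T (k - m).
Proof.
move=> hP hQ PQ tops UP TQ; elim: m k => [|m IH] [|k] mU kT [x [Tx Ux]].
- by split=> //; apply: (KR_occurs hP hQ) => //; exists x.
- by split=> //; apply: (KR_occurs hP hQ) => //; exists x.
- have : bottom Q x by exists T => //; rewrite -nth0.
  rewrite -(KR_top hQ) => -[y /tops yP yx].
  have : bottom P x by rewrite -(KR_top hP); exists y.
  case=> S SP; rewrite -nth0 => Sx.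
  by have [] := KR_disjoint hP UP SP mU (KR_height hP SP) Ux Sx.
- move: Tx Ux; rewrite -(KR_shift hQ TQ kT) -(KR_shift hP UP mU).
  move=> [y Ty <-] [z Uz /phi_inj E]; subst z.
  by rewrite subSS; apply: IH (ltnW _) (ltnW _) _ => //; exists y.
Qed.

(** Indexing the towers by an arbitrary finite type lets the inverse images of the towers of Y be
    labelled by the vertices of the diagram of Y. *)
Definition labels (A : finType) (a : A -> seq (set X)) P : Prop :=
  [/\ injective a, forall v, a v \in P & forall T, T \in P -> exists v, a v = T].

(** E(P, Q) composed with E(Q, R) is E(P, R). Positions add up along a pair; conversely, the tower
    of [Q] met by [T] at the level where [S] starts occurs in [T] and contains the whole occurrence
    of [S]. Occurrences of towers of [Q] in [T] do not overlap, whence injectivity and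
    monotonicity. *)
Lemma occ_edges_comp (A B C : finType) (a : A -> seq (set X))
    (b : B -> seq (set X)) (c : C -> seq (set X)) P Q R ab_inj bc_inj ac_inj :
  is_KR phi x0 P -> is_KR phi x0 Q -> is_KR phi x0 R ->
  labels a P -> labels b Q -> labels c R ->
  refined P Q -> refined Q R -> top Q `<=` top P -> top R `<=` top Q ->
  @occ_edges X A B a b ab_inj \oE @occ_edges X B C b c bc_inj
    =~ @occ_edges X A C a c ac_inj.
Proof.
move=> hP hQ hR [_ aP _] [b_inj bQ Qb] [_ cR _] PQ QR tPQ tQR.
have a0 v := KR_height hP (aP v); have b0 v := KR_height hQ (bQ v).
pose p (e : occ_edges ab_inj \oE occ_edges bc_inj) :=
  occ_pos (val e).2 + occ_pos (val e).1.
have lt_src (e : occ_edges ab_inj) :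
    occ_pos e < size (b (erng (occ_edges ab_inj) e)).
  have [+ _] := occ_posP e; apply: leq_trans.
  by rewrite -addn1 leq_add2l.
apply: (@eiso_occ _ _ _ _ _ _ a0 _ p).
- move=> [[e g] eg]; apply: occurs_trans (occ_posP g).
  have <- : erng (occ_edges ab_inj) e = esrc (occ_edges bc_inj) g := eqP eg.
  exact: occ_posP.
- move=> S T k h; have kT : k < size (c T).
    by case: h => h _; apply: leq_trans h; rewrite -addn1 leq_add2l.
  have [[y Ty] _] := KR_cell hR (KR_nth (cR T) kT).
  have [U [m [UQ mU Uy]]] := KR_at hQ y.
  have [|mk UT] := KR_occurs_at hQ hR QR tQR UQ (cR T) mU kT; first by exists y.
  have SU : occurs (a S) U m.
    apply: (KR_occurs hP hQ) => //; exists y; split=> //.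
    by have [_ /(_ _ (a0 S))] := h; rewrite addn0; apply.
  have [V E] := Qb _ UQ; subst U.
  have [e [es er ep]] := occ_edge_ex ab_inj a0 SU.
  have [g [gs gr gp]] := occ_edge_ex bc_inj b0 UT.
  have eg : erng (occ_edges ab_inj) e = esrc (occ_edges bc_inj) g by rewrite er gs.
  by exists (epair eg); split=> //; rewrite /p /= ep gp subnK.
- move=> [[e g] eg] [[e' g'] eg'] r E; apply/val_inj => /=.
  have {}r : erng (occ_edges bc_inj) g = erng (occ_edges bc_inj) g' := r.
  have Eg : erng (occ_edges ab_inj) e = esrc (occ_edges bc_inj) g := eqP eg.
  have Eg' : erng (occ_edges ab_inj) e' = esrc (occ_edges bc_inj) g' := eqP eg'.
  have oc := occ_posP g; have oc' := occ_posP g'; rewrite r in oc.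
  have [| |Eb Ep] := occurs_uniq hQ hR (bQ _) (bQ _) (cR _) oc oc' _ _ E.
  - by rewrite -Eg; apply: lt_src.
  - by rewrite -Eg'; apply: lt_src.
  rewrite /= in Ep; have Egg : g = g'.
    by apply: (occ_pos_inj r); move: E; rewrite /p /= Ep => /addIn.
  by congr (_, _) => //; apply: occ_pos_inj => //; rewrite Eg Eg' Egg.
- move=> [[e g] eg] [[e' g'] eg']; rewrite /p.
  have Eg : erng (occ_edges ab_inj) e = esrc (occ_edges bc_inj) g := eqP eg.
  case/orP=> /andP[/= gg']; last by move: gg' => /eqP -> /andP[_]; rewrite leq_add2l.
  move=> le; have r := ele_rng (le : ele (occ_edges bc_inj) g g').
  move: le => /andP[_]; rewrite -/(occ_pos g) -/(occ_pos g') => le.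
  have oc := occ_posP g; have oc' := occ_posP g'; rewrite r in oc.
  (* Otherwise [g'] would start within the stretch of levels occupied by [g], and [occurs_uniq]
     would make them start together. *)
  apply: leq_trans (leq_addr _ _); rewrite leqNgt; apply/negP => lt.
  case/eqP: gg'; apply: (occ_pos_inj r); apply/eqP; rewrite eqn_leq le /=.
  have lt' : occ_pos g' - occ_pos g < size (b (esrc (occ_edges bc_inj) g)).
    rewrite ltn_subLR //; apply: leq_trans lt _; rewrite leq_add2l -Eg.
    exact/ltnW/lt_src.
  have [|_ /eqP] := occurs_uniq hQ hR (bQ _) (bQ _) (cR _) oc oc' lt' (b0 _).
  - by rewrite addn0 subnKC.
  - by rewrite subn_eq0.
Qed.

(** The occurrences in a tower of [Q] do not overlap, by [occurs_uniq], and leave no gap, by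
    [KR_occurs_at], so [tiling_offset] applies to their positions. *)
Lemma occ_edges_tiling (A B : finType) (a : A -> seq (set X))
    (b : B -> seq (set X)) P Q ab_inj :
  is_KR phi x0 P -> is_KR phi x0 Q -> labels a P -> labels b Q ->
  refined P Q -> top Q `<=` top P ->
  (forall e : @occ_edges X A B a b ab_inj,
     offset (size \o a) e = occ_pos e) /\
  (forall w, height (@occ_edges X A B a b ab_inj) (size \o a) w = size (b w)).
Proof.
move=> hP hQ [a_inj aP Pa] [_ bQ _] PQ tPQ; have a0 v := KR_height hP (aP v).
apply: tiling_offset => //.
- move=> e e' /andP[ne /andP[/eqP r le]]; rewrite leqNgt; apply/negP => lt.
  have oc := occ_posP e; have oc' := occ_posP e'; rewrite [erng _ e]r in oc.
  have lt' : occ_pos e' - occ_pos e < size (a (esrc (occ_edges ab_inj) e)).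
    by rewrite ltn_subLR.
  have [|_ /eqP] := occurs_uniq hP hQ (aP _) (aP _) (bQ _) oc oc' lt' (a0 _).
  - by rewrite addn0 subnKC.
  - rewrite subn_eq0 => le'; case/eqP: ne; apply: (occ_pos_inj r).
    by apply/eqP; rewrite eqn_leq [X in X && _]le.
- by move=> e; case: (occ_posP e).
- move=> T i iT; have [[y Ty] _] := KR_cell hQ (KR_nth (bQ T) iT).
  have [U [m [UP mU Uy]]] := KR_at hP y.
  have [|mi UT] := KR_occurs_at hP hQ PQ tPQ UP (bQ T) mU iT; first by exists y.
  have [S E] := Pa _ UP; subst U.
  have [e [es er ep]] := occ_edge_ex ab_inj a0 UT; exists e => //.
  by rewrite /covers ep es leq_subr -ltn_subLR ?leq_subr // subKn.
- by move=> e; apply: a0.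
Qed.

Lemma occ_edges_src (A B : finType) (a : A -> seq (set X))
    (b : B -> seq (set X)) P Q ab_inj v :
  is_KR phi x0 P -> is_KR phi x0 Q -> labels a P -> labels b Q ->
  refined P Q -> top Q `<=` top P ->
  exists e, esrc (@occ_edges X A B a b ab_inj) e = v.
Proof.
move=> hP hQ [_ aP _] [_ _ Qb] PQ tPQ; have a0 v' := KR_height hP (aP v').
have [[x ax] _] := KR_cell hP (KR_nth (aP v) (a0 v)).
have [T [k [TQ kT Tx]]] := KR_at hQ x; have [w E] := Qb T TQ; subst T.
have vw : occurs (a v) (b w) k.
  by apply: (KR_occurs hP hQ PQ tPQ) => //; exists x.
by have [e [ev _ _]] := occ_edge_ex ab_inj a0 vw; exists e.
Qed.

Lemma occ_edges_rng (A B : finType) (a : A -> seq (set X))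
    (b : B -> seq (set X)) P Q ab_inj w :
  is_KR phi x0 P -> is_KR phi x0 Q -> labels a P -> labels b Q ->
  refined P Q -> top Q `<=` top P ->
  exists e, erng (@occ_edges X A B a b ab_inj) e = w.
Proof.
move=> hP hQ aP bQ PQ tPQ.
have [_ ht] := occ_edges_tiling ab_inj hP hQ aP bQ PQ tPQ.
have [|e ew _] := @offset_cover _ _ (occ_edges ab_inj) (size \o a) w 0.
  by rewrite ht; case: bQ => _ bQ _; apply: KR_height hQ _ (bQ w).
by exists e.
Qed.

End KRPartitions.

(** * Kakutani-Rokhlin partitions of a system *)

(** Cantor's intersection theorem, by a cluster point of the filter that the sets generate. *)
Lemma compact_nested (X : topologicalType) (D : nat -> set X) :
  compact [set: X] -> (forall n, closed (D n)) -> (forall n, D n !=set0) ->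
  (forall n, D n.+1 `<=` D n) -> exists x, forall n, D n x.
Proof.
move=> cX cD D0 Dsub.
have Dle m n : m <= n -> D n `<=` D m.
  move=> /subnK <-; elim: (n - m) => // d IH; exact: subset_trans (Dsub _) IH.
have FF : ProperFilter (filter_from [set: nat] D).
  apply: filter_from_proper => [|n _]; last exact: D0.
  apply: filter_from_filter; first by exists 0.
  move=> m n _ _; exists (maxn m n) => //; rewrite subsetI.
  by split; apply: Dle; rewrite ?leq_maxl ?leq_maxr.
have [|x [_ xD]] := cX _ FF; first exact: filterT.
by exists x => n; apply: cD => B Bx; apply: xD => //; exists n.
Qed.

Section KRSets.
Variables (X : topologicalType) (phi : X -> X) (x0 : X).
Variable P : {fset seq (set X)}.
Hypothesis hP : is_KR phi x0 P.

Lemma KR_cell_eq A B x : cells P A -> cells P B -> A x -> B x -> A = B.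
Proof.
move=> [S SP AS] [T TP BT] Ax Bx.
have AE : nth set0 S (index A S) = A by rewrite nth_index.
have BE : nth set0 T (index B T) = B by rewrite nth_index.
have [] := @KR_disjoint _ _ _ _ hP S T (index A S) (index B T) x SP TP;
  rewrite ?index_mem ?AE ?BE //.
by move=> E1 E2; rewrite -AE -BE E2 E1.
Qed.

Lemma KR_saturated_open (D : set X) :
  (forall A x, cells P A -> A x -> D x -> A `<=` D) -> open D.
Proof.
move=> sat; rewrite openE => x Dx; have [A PA Ax] := KR_cover hP x.
apply: (@filterS _ _ _ A); first exact: sat PA Ax Dx.
by apply: open_nbhs_nbhs; split=> //; have [_ []] := KR_cell hP PA.
Qed.

Lemma KR_saturated_closed (D : set X) :
  (forall A x, cells P A -> A x -> D x -> A `<=` D) -> closed D.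
Proof.
move=> sat; rewrite -[D]setCK; apply: open_closedC; apply: KR_saturated_open.
by move=> A x PA Ax nDx y Ay Dy; apply: nDx; apply: sat PA Ay Dy _ Ax.
Qed.

Lemma KR_last_cell T : T \in P -> cells P (last set0 T).
Proof.
move=> TP; exists T => //; rewrite -nth_last; apply: mem_nth.
by rewrite prednK // (KR_height hP TP).
Qed.

Lemma KR_top_closed : closed (top P).
Proof.
apply: KR_saturated_closed => A x PA Ax [T TP Tx].
rewrite (KR_cell_eq PA (KR_last_cell TP) Ax Tx) => y Ty; exact: (ex_intro2 _ _ T).
Qed.

Lemma KR_top_open : open (top P).
Proof.
apply: KR_saturated_open => A x PA Ax [T TP Tx].
rewrite (KR_cell_eq PA (KR_last_cell TP) Ax Tx) => y Ty; exact: (ex_intro2 _ _ T).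
Qed.

End KRSets.

Lemma refined_trans (X : topologicalType) (P Q R : {fset seq (set X)}) :
  refined P Q -> refined Q R -> refined P R.
Proof.
move=> PQ QR C /QR[B /PQ[A PA BA] CB]; exists A => //; exact: subset_trans BA.
Qed.

Section SystemTowers.
Variables (R : realType) (X : sds R).

Lemma shift_inj : injective (shift X).
Proof. by have [_ [psi [/can_inj ? _ _]]] := shift_homeo X. Qed.

Lemma KR_refined_le m n : m <= n -> refined (KR X m) (KR X n).
Proof.
move=> /subnK <-; elim: (n - m) => [|d IH]; first by move=> A; exists A.
by rewrite addSn; apply: refined_trans IH (@KR_refined _ X _).
Qed.

Lemma KR_top_le m n : m <= n -> top (KR X n) `<=` top (KR X m).
Proof.
move=> /subnK <-; elim: (n - m) => // d IH.
by rewrite addSn; apply: subset_trans (@KR_top_sub _ X _) IH.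
Qed.

Lemma KR_labels n :
  @labels X (sds_vtx X n) (fun T => val T) (KR X n).
Proof.
split=> [|T|T TP]; [exact: val_inj|exact: valP|].
by exists [` TP]%fset.
Qed.

(** Telescoping with [occ_edges_comp], starting from the fact that within one partition a tower
    occurs only in itself, at position 0. *)
Lemma epath_tower k l : k <= l ->
  epath (sds_diagram X) k l =~ tower_edges (KR_isKR X k) (KR_isKR X l).
Proof.
have id_tower : epath (sds_diagram X) k k
    =~ tower_edges (KR_isKR X k) (KR_isKR X k).
  have size_gt0 (S : KR X k) : 0 < size (val S).
    exact: (KR_height (KR_isKR X k) (valP S)).
  rewrite /epath epathsnn.
  apply: (@eiso_occ _ _ _ _ _ _ size_gt0 _ (fun => 0)) => //=.
  - by move=> S; split=> [|j _]; [rewrite add0n|apply: subset_refl].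
  - move=> S T j [jT ST]; have S0 := size_gt0 S.
    have kT : j + 0 < size (val T) by apply: leq_trans jT; rewrite ltn_add2l.
    have [[y Ty] _] := KR_cell (KR_isKR X k) (KR_nth (valP T) kT).
    have [E] := KR_disjoint (KR_isKR X k) (valP T) (valP S) kT S0 Ty (ST _ S0 _ Ty).
    by rewrite addn0 => ->; exists S; split=> //; apply/val_inj.
elim: l => [|l IH]; rewrite leq_eqVlt => /predU1P[<- //|//]; rewrite ltnS => kl.
rewrite /epath epathsS //; apply: eiso_trans (eiso_compl _ (IH kl)) _.
apply: (occ_edges_comp shift_inj _ _ _ (KR_isKR X k) (KR_isKR X l) (KR_isKR X l.+1)
  (KR_labels k) (KR_labels l) (KR_labels l.+1)).
- exact: KR_refined_le.
- exact: KR_refined.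
- exact: KR_top_le.
- exact: KR_top_sub.
Qed.

Lemma top_base x : (forall n, top (KR X n) x) -> x = base X.
Proof.
move=> xt; suff : [set base X] x by [].
by rewrite -KR_top_cap => n _; apply: xt.
Qed.

(** A neighbourhood of x contains a cell around x of some level n, hence the common cell of level
    max(n, N), hence y; X is Hausdorff. Restricting to large levels is what [limit_shift] can
    provide. *)
Lemma KR_separated x y :
  (exists N, forall n, N <= n -> exists A, [/\ cells (KR X n) A, A x & A y]) ->
  x = y.
Proof.
move=> [N HN]; apply: (metrizable_hausdorff (carrier_metrizable X)) => U V Ux Vy.
have /((KR_basis X).2 x)[A [[n _ nA] Ax] AU] := Ux.
have [B [nB Bx By]] := HN _ (leq_maxr n N).
have [A' nA' BA'] := KR_refined_le (leq_maxl n N) nB.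
exists y; split; last exact: nbhs_singleton.
by apply: AU; rewrite (KR_cell_eq (KR_isKR X n) nA nA' Ax (BA' _ Bx)); apply: BA'.
Qed.

(** Otherwise the closed decreasing sets [top (KR X n) \ U] are non-empty and share a point, which
    can only be the base point, although that lies in [U]. *)
Lemma KR_top_small (U : set X) : open U -> U (base X) ->
  exists L, forall l, L <= l -> top (KR X l) `<=` U.
Proof.
move=> oU Ux0; apply: contrapT => nex.
have [||||x xD] := @compact_nested X (fun n => top (KR X n) `\` U).
- exact: carrier_compact.
- move=> n; apply: closedI; first exact: KR_top_closed (KR_isKR X n).
  exact: open_closedC.
- move=> n; apply/set0P/negP => /eqP E; apply: nex; exists n => l nl x /(KR_top_le nl) xt.
  apply: contrapT => nUx; suff : (top (KR X n) `\` U) x by rewrite E.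
  by [].
- by move=> n x [/KR_top_sub].
have E : x = base X by apply: top_base => n; have [] := xD n.
by have [_] := xD 0; rewrite E.
Qed.

End SystemTowers.

(** * Inverse images of towers *)

Section PreimageTowers.
Variables (R : realType) (X Y : sds R) (a : sds_map X Y).
Hypothesis a_onto : forall y, exists x, a x = y.

Lemma nth_preim S j : nth set0 (preim_tower a S) j = a @^-1` nth set0 S j.
Proof.
have [jS|jS] := ltnP j (size S); first by rewrite (nth_map set0).
by rewrite !nth_default ?size_map ?preimage_set0.
Qed.

Lemma last_preim S : last set0 (preim_tower a S) = a @^-1` last set0 S.
Proof. by rewrite -!nth_last nth_preim size_map. Qed.

Lemma head_preim S : head set0 (preim_tower a S) = a @^-1` head set0 S.
Proof. by rewrite -!nth0 nth_preim. Qed.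

Lemma occurs_preim S T k :
  occurs (preim_tower a S) (preim_tower a T) k <-> occurs S T k.
Proof.
rewrite /occurs !size_map; split=> -[kT ST]; split=> // j jS.
  move=> y; have [x <-] := a_onto y; have := ST j jS.
  by rewrite !nth_preim; apply.
by rewrite !nth_preim; apply: preimage_subset; apply: ST.
Qed.

Lemma cells_preim n : cells (preim_KR a n) = preimage a @` cells (KR Y n).
Proof.
apply/seteqP; split=> A.
  case=> T /imfsetP[S /= SP ->] /mapP[B BS ->].
  by exists B => //; exists S.
case=> B [S SP BS] <-; exists (preim_tower a S); first by apply/imfsetP; exists S.
exact: map_f.
Qed.

Lemma top_preim n : top (preim_KR a n) = a @^-1` top (KR Y n).
Proof.
apply/seteqP; split=> x.
  by case=> T /imfsetP[S /= SP ->]; rewrite last_preim; exists S.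
case=> S SP Sx; exists (preim_tower a S); first by apply/imfsetP; exists S.
by rewrite last_preim.
Qed.

Lemma bottom_preim n : bottom (preim_KR a n) = a @^-1` bottom (KR Y n).
Proof.
apply/seteqP; split=> x.
  by case=> T /imfsetP[S /= SP ->]; rewrite head_preim; exists S.
case=> S SP Sx; exists (preim_tower a S); first by apply/imfsetP; exists S.
by rewrite head_preim.
Qed.

Lemma refined_preim m n : m <= n -> refined (preim_KR a m) (preim_KR a n).
Proof.
move=> mn A; rewrite !cells_preim => -[B /(KR_refined_le mn)[C mC BC] <-].
by exists (a @^-1` C); [exists C|apply: preimage_subset].
Qed.

Lemma image_shift_preim (B : set Y) :
  shift X @` (a @^-1` B) = a @^-1` (shift Y @` B).
Proof.
have [_ [psi [_ psiK _]]] := shift_homeo X.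
apply/seteqP; split=> x.
  by case=> z Bz <-; exists (a z) => //; rewrite smap_shift.
case=> y By; rewrite -[x]psiK smap_shift => /shift_inj E.
by exists (psi x) => //; rewrite /preimage /= -E.
Qed.

Lemma preim_is_KR n : is_KR (shift X) (base X) (preim_KR a n).
Proof.
have hY := KR_isKR Y n; split.
- by move=> T /imfsetP[S /= SP ->]; rewrite size_map; apply: KR_height hY _ SP.
- move=> A; rewrite cells_preim => -[B /(KR_cell hY)[[y By] cB] <-]; split.
    by have [x xy] := a_onto y; exists x; rewrite /preimage /= xy.
  by apply: preimage_clopen cB _; apply: smap_continuous.
- move=> x; have [B PB Bx] := KR_cover hY (a x).
  by exists (a @^-1` B) => //; rewrite cells_preim; exists B.
- move=> _ _ i j x /imfsetP[S /= SP ->] /imfsetP[T /= TP ->].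
  rewrite !size_map !nth_preim => iS jT Sx Tx.
  by have [-> ->] := KR_disjoint hY SP TP iS jT Sx Tx.
- move=> _ j /imfsetP[S /= SP ->]; rewrite size_map => jS.
  by rewrite !nth_preim image_shift_preim (KR_shift hY).
- by rewrite top_preim /preimage /= smap_base; apply: KR_base hY.
- by rewrite top_preim bottom_preim image_shift_preim (KR_top hY).
Qed.

Lemma preim_labels n :
  @labels X (sds_vtx Y n) (fun S => preim_tower a (val S)) (preim_KR a n).
Proof.
split.
- apply: inj_comp val_inj; apply: inj_map => A B /seteqP[AB BA].
  apply/seteqP; split=> y; have [x <-] := a_onto y; [exact: AB|exact: BA].
- by move=> S; apply/imfsetP; exists (val S) => //; apply: valP.
- by move=> T /imfsetP[S /= SP ->]; exists [` SP]%fset.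
Qed.

Definition adapted n l := refined (preim_KR a n) (KR X l) /\
  top (KR X l) `<=` top (preim_KR a n).

Lemma adapted_le m n k l : m <= n -> k <= l -> adapted n k -> adapted m l.
Proof.
move=> mn kl [r t]; split.
  apply: refined_trans (KR_refined_le kl); apply: refined_trans r.
  exact: refined_preim.
apply: subset_trans (KR_top_le kl) _; apply: subset_trans t _.
by rewrite !top_preim; apply: preimage_subset; apply: KR_top_le.
Qed.

(** With [tower_map_edges], this evaluates the two sides of the commutation relation of a
    premorphism: both are the edge set of the map between the outer levels. *)
Lemma map_edges_tower n l m : l <= m -> adapted n l ->
  map_edges a n l \oE tower_edges (KR_isKR X l) (KR_isKR X m)
    =~ map_edges a n m.
Proof.
move=> lm [r t]; apply: (occ_edges_comp (@shift_inj _ X) _ _ _ (preim_is_KR n)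
  (KR_isKR X l) (KR_isKR X m) (preim_labels n) (KR_labels X l) (KR_labels X m)) => //.
- exact: KR_refined_le.
- exact: KR_top_le.
Qed.

Lemma tower_map_edges m n l : m <= n -> adapted n l ->
  tower_edges (KR_isKR Y m) (KR_isKR Y n) \oE map_edges a n l
    =~ map_edges a m l.
Proof.
move=> mn [r t].
have pre_inj (S S' : KR Y m) (T : KR Y n) k :
    occurs (preim_tower a (val S)) (preim_tower a (val T)) k ->
    occurs (preim_tower a (val S')) (preim_tower a (val T)) k -> S = S'.
  move=> /occurs_preim h /occurs_preim.
  exact: (tower_edges_inj (KR_isKR Y m) (KR_isKR Y n) h).
have S0 (S : KR Y m) : 0 < size (val S).
  exact: (KR_height (KR_isKR Y m) (valP S)).
(* The edges between levels of Y are first moved to X: as [a] is onto, towers occur in each other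
   exactly when their inverse images do. *)
apply: (@eiso_trans _ _ (occ_edges pre_inj \oE map_edges a n l)).
  apply/eiso_compl/eiso_occ_occ => // [S|S T k]; first by rewrite size_map.
  by split=> /occurs_preim.
apply: (occ_edges_comp (@shift_inj _ X) _ _ _ (preim_is_KR m)
  (preim_is_KR n) (KR_isKR X l) (preim_labels m) (preim_labels n) (KR_labels X l)) => //.
- exact: refined_preim.
- by rewrite !top_preim; apply: preimage_subset; apply: KR_top_le.
Qed.

Lemma map_edges_offset n l (e : map_edges a n l) : adapted n l ->
  offset (fun S : sds_vtx Y n => size (val S)) e = occ_pos e.
Proof.
move=> [r t].
have [off _] := occ_edges_tiling (@shift_inj _ X) (@map_edges_inj _ _ _ a n l)
  (preim_is_KR n) (KR_isKR X l) (preim_labels n) (KR_labels X l) r t.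
rewrite -off; congr offset; apply: funext => S.
by rewrite /= size_map.
Qed.

(** Compactness, used twice: [KR_top_small] handles the tops, and a nested intersection handles the
    refinement. *)
Lemma adapted_ex n : exists L, forall l, L <= l -> adapted n l.
Proof.
have [L HL] : exists L, forall l, L <= l -> top (KR X l) `<=` top (preim_KR a n).
  apply: KR_top_small; first exact: KR_top_open (preim_is_KR n).
  exact: KR_base (preim_is_KR n).
suff [M HM] : exists M, refined (preim_KR a n) (KR X M).
  exists (maxn L M) => l; rewrite geq_max => /andP[/HL t Ml]; split=> //.
  exact: refined_trans HM (KR_refined_le Ml).
apply: contrapT => nex.
(* [D l] is the union of the cells of level [l] that fit in no cell of the inverse image partition.
   A point common to all [D l] would contradict the basis property, applied to the clopen cell
   around it. *)
pose D l := [set x | forall A B, cells (KR X l) A -> A x ->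
  cells (preim_KR a n) B -> ~ A `<=` B].
have [||||x xD] := @compact_nested X D.
- exact: carrier_compact.
- move=> l; apply: KR_saturated_closed (KR_isKR X l) _ _.
  move=> A x lA Ax Dx y Ay A' B lA' A'y.
  by rewrite -(KR_cell_eq (KR_isKR X l) lA lA' Ay A'y); apply: Dx.
- move=> l; apply/set0P/negP => /eqP E; apply: nex; exists l => A lA.
  have [[x Ax] _] := KR_cell (KR_isKR X l) lA.
  apply: contrapT => nB; have : D l x; last by rewrite E.
  move=> A' B lA' A'x nBc AB; apply: nB; exists B => //.
  by rewrite (KR_cell_eq (KR_isKR X l) lA lA' Ax A'x).
- move=> l x Dx A B lA Ax nB AB.
  have [C sC Cx] := KR_cover (KR_isKR X l.+1) x.
  have [A' lA' CA'] := KR_refined sC.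
  apply: (Dx _ _ sC Cx nB); apply: subset_trans AB.
  by rewrite (KR_cell_eq (KR_isKR X l) lA lA' Ax (CA' _ Cx)).
have [B nB Bx] := KR_cover (preim_is_KR n) x.
have [_ [oB _]] := KR_cell (preim_is_KR n) nB.
have /((KR_basis X).2 x)[A [[l _ lA] Ax] AB] : nbhs x B.
  by apply: open_nbhs_nbhs.
exact: xD l _ _ lA Ax nB AB.
Qed.

End PreimageTowers.

(** * The functor and its faithfulness *)

(** The level is a variable equal to 0 because [pidx f 0] is only provably 0; this avoids casts. *)
Lemma KR_0_size (R : realType) (X : sds R) n (T : sds_vtx X n) :
  n = 0 -> size (val T) = 1.
Proof.
move=> n0; subst n; move: (val T) (valP T : val T \in KR X 0) => S.
by rewrite KR_0 inE => /eqP ->.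
Qed.

Section RepresentingPremorphism.
Variables (R : realType) (X Y : sds R) (a : sds_map X Y).
Hypothesis a_onto : forall y, exists x, a x = y.
Variable f : nat -> nat.
Hypotheses (f0 : f 0 = 0) (f_le : forall n, f n <= f n.+1)
  (f_unbounded : forall N, exists n, N <= f n)
  (f_adapted : forall n, adapted a n (f n)).

Lemma map_edges_src n (v : vtx (sds_diagram Y) n) :
  exists e : map_edges a n (f n), esrc (map_edges a n (f n)) e = v.
Proof.
have [r t] := f_adapted n.
exact: (occ_edges_src _ _ (preim_is_KR a_onto n) (KR_isKR X _)
  (preim_labels a_onto n) (KR_labels X _) r t).
Qed.

Lemma map_edges_rng n (w : vtx (sds_diagram X) (f n)) :
  exists e : map_edges a n (f n), erng (map_edges a n (f n)) e = w.
Proof.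
have [r t] := f_adapted n.
exact: (occ_edges_rng (@shift_inj _ X) _ _ (preim_is_KR a_onto n) (KR_isKR X _)
  (preim_labels a_onto n) (KR_labels X _) r t).
Qed.

Lemma map_edges_gt0 n : 0 < #|map_edges a n (f n)|.
Proof.
have /card_gt0P[v _] := sds_vtx_gt0 Y n; have [e _] := map_edges_src v.
by apply/card_gt0P; exists e.
Qed.

Lemma map_edges0_card : #|map_edges a 0 (f 0)| = 1.
Proof.
apply/eqP; rewrite eqn_leq map_edges_gt0 andbT; apply/card_le1_eqP => e e' _ _.
have pos0 (g : map_edges a 0 (f 0)) : occ_pos g = 0.
  have [+ _] := occ_posP g; rewrite (KR_0_size _ f0) size_map (KR_0_size _ erefl).
  by rewrite addn1 ltnS leqn0 => /eqP.
apply: occ_pos_inj; last by rewrite !pos0.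
have /fintype_le1P H : #|sds_vtx X (f 0)| <= 1 by rewrite f0 sds_vtx0.
exact: H.
Qed.

Lemma map_edges_comm n : edg (sds_diagram Y) n \oE map_edges a n.+1 (f n.+1) =~
  map_edges a n (f n) \oE epath (sds_diagram X) (f n) (f n.+1).
Proof.
apply: eiso_trans (tower_map_edges a_onto (leqnSn n) (f_adapted n.+1)) _.
apply: eiso_sym; apply: eiso_trans (eiso_compr _ (epath_tower X (f_le n))) _.
exact: map_edges_tower.
Qed.

Definition map_premor : premor (sds_diagram Y) (sds_diagram X) :=
  @Premor (sds_diagram Y) (sds_diagram X) f (fun n => map_edges a n (f n))
    f0 f_le f_unbounded map_edges_gt0 map_edges_src map_edges_rng
    map_edges0_card map_edges_comm.

End RepresentingPremorphism.

Section Representatives.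
Variables (R : realType) (X Y : sds R) (a : sds_map X Y).
Hypothesis a_onto : forall y, exists x, a x = y.

Lemma represents_ex : exists f, represents a f.
Proof.
pose L n := projT1 (cid (adapted_ex a_onto n)).
(* These partial sums start at 0, increase, dominate n, and for positive n exceed [L n]. Level 0 is
   adapted because both partitions are trivial there. *)
pose f n := \sum_(i < n) (L i.+1).+1.
have fS n : f n.+1 = f n + (L n.+1).+1 by rewrite /f big_ord_recr.
have f0 : f 0 = 0 by rewrite /f big_ord0.
have f_le n : f n <= f n.+1 by rewrite fS leq_addr.
have f_ge n : n <= f n.
  elim: n => // n IH; rewrite fS addnS ltnS; exact: leq_trans IH (leq_addr _ _).
have f_unb N : exists n, N <= f n by exists N.
have f_ad n : adapted a n (f n).
  case: n => [|n]; last first.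
    apply: (projT2 (cid (adapted_ex a_onto n.+1))).
    by rewrite fS addnS ltnW // ltnS leq_addl.
  rewrite f0; split=> [A _|x _].
    exists setT => //; rewrite cells_preim; exists setT; last exact: preimage_setT.
    by exists [:: setT]; rewrite ?KR_0 inE.
  by rewrite top_preim; exists [:: setT]; rewrite ?KR_0 ?inE.
exists (map_premor a_onto f0 f_le f_unb f_ad) => n.
by have [r t] := f_ad n; split.
Qed.

(** Extended to level [l], the edge sets depend on [a] alone and not on the chosen sequence; hence
    the class of [f] depends only on [a]. *)
Lemma represents_path f n l : represents a f -> pidx f n <= l ->
  pedg f n \oE epath (sds_diagram X) (pidx f n) l =~ map_edges a n l.
Proof.
move=> /(_ n)[r t E] fl; apply: eiso_trans (eiso_compr _ (epath_tower X fl)) _.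
rewrite E; exact: map_edges_tower.
Qed.

Lemma represents_pequiv f g : represents a f -> represents a g -> pequiv f g.
Proof.
move=> fa ga; apply/pequivP => n; exists (maxn (pidx f n) (pidx g n)).
split; rewrite ?leq_maxl ?leq_maxr //.
apply: eiso_trans (represents_path fa _) (eiso_sym (represents_path ga _)).
- exact: leq_maxl.
- exact: leq_maxr.
Qed.

End Representatives.

Lemma represents_id (R : realType) (X : sds R) f :
  represents (sval (sds_idm X)) f -> pequiv f (idp (sds_diagram X)).
Proof.
move=> fa; apply/pequivP => n; exists (maxn (pidx f n) n).
have id_onto : forall y : X, exists x, sval (sds_idm X) x = y by move=> y; exists y.
have nl := leq_maxr (pidx f n) n.
split; rewrite ?leq_maxl //.
apply: eiso_trans (represents_path id_onto fa (leq_maxl _ _)) _; apply: eiso_sym.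
apply: eiso_trans (epath_cat _ (leqnn n) nl) _.
apply: eiso_trans (epath_tower X nl) _; apply: eiso_occ_occ => //.
- by move=> S; apply: (KR_height (KR_isKR X n) (valP S)).
- by move=> S; rewrite size_map; apply: (KR_height (KR_isKR X n) (valP S)).
- by move=> S T k; rewrite /preim_tower (_ : preimage _ = id) ?map_id.
Qed.

(** Another instance of [occ_edges_comp], for the inverse images in X of the partitions of Z and of
    Y; the edges of [b] are moved to X by inverse images under [a]. *)
Lemma map_edges_comp (R : realType) (X Y Z : sds R) (b : sds_hom Y Z)
    (a : sds_hom X Y) n m l :
  adapted (sval b) n m -> adapted (sval a) m l ->
  map_edges (sval b) n m \oE map_edges (sval a) m l
    =~ map_edges (sval (sds_cmp b a)) n l.
Proof.
move=> [br bt] [ar at_]; set c := sval (sds_cmp b a).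
have cE S : preim_tower c S = preim_tower (sval a) (preim_tower (sval b) S).
  by rewrite /preim_tower -map_comp.
have pre_inj (S S' : KR Z n) (T : KR Y m) k :
    occurs (preim_tower c (val S)) (preim_tower (sval a) (val T)) k ->
    occurs (preim_tower c (val S')) (preim_tower (sval a) (val T)) k -> S = S'.
  rewrite !cE => /(occurs_preim (svalP a)) h /(occurs_preim (svalP a)).
  exact: map_edges_inj h.
have S0 (S : KR Z n) : 0 < size (val S).
  exact: (KR_height (KR_isKR Z n) (valP S)).
apply: (@eiso_trans _ _ (occ_edges pre_inj \oE map_edges (sval a) m l)).
  apply/eiso_compl/eiso_occ_occ => [S|S|S T k]; rewrite ?size_map //.
  by rewrite cE; split=> /(occurs_preim (svalP a)).
apply: (occ_edges_comp (@shift_inj _ X) _ _ _ (preim_is_KR (svalP (sds_cmp b a)) n)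
  (preim_is_KR (svalP a) m) (KR_isKR X l) (preim_labels (svalP (sds_cmp b a)) n)
  (preim_labels (svalP a) m) (KR_labels X l)) => //.
- move=> A; rewrite !cells_preim => -[B /br + <-].
  rewrite cells_preim => -[_ [C nC <-] BC].
  by exists (c @^-1` C); [exists C|move=> x; apply: BC].
- rewrite !top_preim => x /bt; rewrite top_preim; exact.
Qed.

Lemma represents_comp (R : realType) (X Y Z : sds R) (b : sds_hom Y Z)
    (a : sds_hom X Y) f g h :
  represents (sval b) g -> represents (sval a) f ->
  represents (sval (sds_cmp b a)) h -> pequiv h (compp f g).
Proof.
move=> gb fa hc; apply/pequivP => n.
pose l := maxn (pidx h n) (pidx f (pidx g n)); exists l.
have fl : pidx f (pidx g n) <= l by apply: leq_maxr.
split=> //; first exact: leq_maxl.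
apply: eiso_trans (represents_path (svalP (sds_cmp b a)) hc (leq_maxl _ _)) _.
apply: eiso_sym; apply: eiso_trans (eiso_sym (ecompA _ _ _)) _.
apply: eiso_trans (eiso_compr _ (represents_path (svalP a) fa fl)) _.
have [br bt ->] := gb n; have [ar at_ _] := fa (pidx g n).
apply: map_edges_comp => //.
by apply: (adapted_le (leqnn _) fl); split.
Qed.

(** Let x lie at level k of a tower T of X and [sval a x] at level m of S. The inverse image of S
    under a occurs in T at k - m. The isomorphism preserves source, range and offset, so the one
    under b occurs there too, and b sends x to level m of S. *)
Lemma map_edges_eiso_cell (R : realType) (X Y : sds R) (a b : sds_hom X Y) n l x :
  adapted (sval a) n l -> adapted (sval b) n l ->
  map_edges (sval a) n l =~ map_edges (sval b) n l ->
  exists A, [/\ cells (KR Y n) A, A (sval a x) & A (sval b x)].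
Proof.
move=> aa ab [h [hb hs hr hle]].
have hP := preim_is_KR (svalP a) n; have hX := KR_isKR X l.
have [T [k [TX kT Tx]]] := KR_at hX x.
have [U [m [UP mU Ux]]] := KR_at hP x.
have [|mk UT] := KR_occurs_at (@shift_inj _ X) hP hX aa.1 aa.2 UP TX mU kT.
  by exists x.
have [_ _ Ul] := preim_labels (svalP a) n; have [S SU] := Ul _ UP; subst U.
have size_gt0 (S' : KR Y n) : 0 < size (preim_tower (sval a) (val S')).
  by rewrite size_map; apply: (KR_height (KR_isKR Y n) (valP S')).
have [e [es er ep]] := occ_edge_ex (@map_edges_inj _ _ _ (sval a) n l)
  size_gt0 (UT : occurs _ (val [` TX]%fset) _).
have := occ_posP (h e).
rewrite -(map_edges_offset (svalP b) _ ab) (offset_iso _ hb hs hle).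
rewrite (map_edges_offset (svalP a) _ aa) ep [esrc _ (h e)]hs [erng _ (h e)]hr.
rewrite [esrc _ e]es [erng _ e]er.
move=> [_ /(_ m)]; rewrite !size_map in mU *; move=> /(_ mU); rewrite subnK //.
move=> /(_ x Tx) Sb; exists (nth set0 (val S) m); split.
- exact: KR_nth (valP S) mU.
- by move: Ux; rewrite nth_preim.
- by move: Sb; rewrite nth_preim.
Qed.

Lemma represents_faithful (R : realType) (X Y : sds R) (a b : sds_hom X Y) f g :
  represents (sval a) f -> represents (sval b) g -> pequiv f g -> a = b.
Proof.
move=> fa gb /pequivP fg; apply: sds_homP => x; apply: KR_separated.
exists 0 => n _; have [l [fl gl I]] := fg n.
have [ra ta _] := fa n; have [rb tb _] := gb n.
apply: (@map_edges_eiso_cell _ _ _ a b n l).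
- by apply: (adapted_le (leqnn n) fl).
- by apply: (adapted_le (leqnn n) gl).
- apply: eiso_trans (eiso_sym (represents_path (svalP a) fa fl)) _.
  exact: eiso_trans I (represents_path (svalP b) gb gl).
Qed.

(** * Fullness *)

Section PathHeights.
Variables (R : realType) (X : sds R).

Definition tsize n (T : sds_vtx X n) : nat := size (val T).

Lemma tsize_gt0 n (T : sds_vtx X n) : 0 < tsize T.
Proof. exact: (KR_height (KR_isKR X n) (valP T)). Qed.

Lemma tower_edges_tiling k l : k <= l ->
  (forall g : tower_edges (KR_isKR X k) (KR_isKR X l),
     offset (@tsize k) g = occ_pos g) /\
  (forall T, height (tower_edges (KR_isKR X k) (KR_isKR X l)) (@tsize k) T
     = tsize T).
Proof.
move=> kl; apply: (occ_edges_tiling (@shift_inj _ X) _ (KR_isKR X k)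
  (KR_isKR X l) (KR_labels X k) (KR_labels X l)).
- exact: KR_refined_le.
- exact: KR_top_le.
Qed.

Lemma epath_height k l T : k <= l ->
  height (epath (sds_diagram X) k l) (@tsize k) T = tsize T.
Proof.
move=> kl; have [_ ht] := tower_edges_tiling kl.
by rewrite (eiso_height _ _ (epath_tower X kl)) ht.
Qed.

(** Paths carry no positions of their own; transport along [epath_tower] shows that their offsets
    play that part. *)
Lemma epath_occurs k l (g : epath (sds_diagram X) k l) : k <= l ->
  occurs (val (esrc (epath (sds_diagram X) k l) g))
    (val (erng (epath (sds_diagram X) k l) g)) (offset (@tsize k) g).
Proof.
move=> kl; have [off _] := tower_edges_tiling kl.
have [h [hb hs hr hle]] := epath_tower X kl.
rewrite -(offset_iso _ hb hs hle) off -hs -hr; exact: occ_posP.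
Qed.

End PathHeights.

(** * The map of systems defined by a premorphism *)

Section LimitMap.
Variables (R : realType) (X Y : sds R).
Variable f : premor (sds_diagram Y) (sds_diagram X).
Local Notation F n := (pedg f n).
Local Notation off e := (offset (@tsize _ Y _) e).

(** Heights agree on both sides of the relation between levels 0 and n. Root towers have height 1
    and F_0 is a single edge, so the right side gives the height of [T]; on the left, the paths from
    the root give the weights [tsize] to F_n. *)
Lemma premor_height n T : height (F n) (@tsize _ Y n) T = tsize T.
Proof.
have F0_height T0 : height (F 0) (@tsize _ Y 0) T0 = tsize T0.
  have [e0 e0T] := pedg_rng T0.
  have F0 e : e = e0.
    by have /eq_leq/fintype_le1P H := pedg0_card f; apply: H.
  rewrite /height (bigD1 e0) /=; last by rewrite e0T.
  rewrite big1 => [|e /andP[_ /eqP[]]]; last exact: F0.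
  by rewrite addn0 /tsize !KR_0_size ?pidx0.
have := eiso_height (@tsize _ Y 0) T (pedg_comm_path f (leq0n n)).
rewrite !height_comp (_ : height (epath (sds_diagram Y) 0 n) _ = @tsize _ Y n).
  move=> ->; rewrite (_ : height (F 0) _ = @tsize _ X _); last exact: funext.
  by rewrite epath_height // pidx_mono.
by apply: funext => S; rewrite epath_height.
Qed.

Lemma offset_tsize n (e : F n) :
  off e + tsize (esrc (F n) e) <= tsize (erng (F n) e).
Proof. by rewrite -[leqRHS]premor_height; apply: offset_height. Qed.

(** Pair [e'] with the edge g of position [k] and apply the commutation isomorphism, giving (e, g').
    Equal offsets mean that [off e' + k] is the position of g' plus [off e], and g' places the
    levels of the upper tower inside those of the lower one. *)
Lemma premor_nested n (e' : F n.+1) (S : sds_vtx Y n) k :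
  occurs (val S) (val (esrc (F n.+1) e')) k -> exists e : F n, esrc (F n) e = S /\
  forall j, j < tsize S -> nth set0 (val (erng (F n.+1) e')) (off e' + (k + j))
    `<=` nth set0 (val (erng (F n) e)) (off e + j).
Proof.
move=> oc.
have [g [gs gr gp]] := occ_edge_ex
  (tower_edges_inj (KR_isKR Y n) (KR_isKR Y n.+1)) (@tsize_gt0 _ Y n) oc.
have [h [hb hs hr hle]] := pedg_comm f n.
pose p := epair (gr : erng (edg (sds_diagram Y) n) g = _).
have := offset_iso (@tsize _ Y n) hb hs hle p; rewrite !offset_comp /=.
have [ho hh] := tower_edges_tiling Y (leqnSn n).
have fle := pidx_le f n.
rewrite (_ : height (F n) _ = @tsize _ X _); last exact/funext/premor_height.
rewrite (_ : height (sds_edg Y n) _ = @tsize _ Y n.+1); last exact/funext/hh.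
rewrite (ho g : off g = _) gp.
have := hs p; have := hr p; case: (h p) => -[e g'] /= eg' r s E.
have {}s : esrc (F n) e = S := etrans s gs.
exists e; split=> //.
move=> j jS; have [_ /(_ (off e + j))] := epath_occurs g' fle.
rewrite r (_ : esrc _ g' = erng (F n) e); last by rewrite (eqP eg').
rewrite !addnA -E; apply; apply: leq_trans (offset_tsize e).
by rewrite ltn_add2l s.
Qed.

(* [y] lies in the cell c_n(x). *)
Definition code n (x : X) (y : Y) : Prop := exists (e : F n) i,
  [/\ i < tsize (esrc (F n) e),
      nth set0 (val (erng (F n) e)) (off e + i) x &
      nth set0 (val (esrc (F n) e)) i y].

Lemma code_cover n (T : sds_vtx X (pidx f n)) k : k < tsize T ->
  exists (e : F n) i, [/\ erng (F n) e = T, off e + i = k &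
    i < tsize (esrc (F n) e)].
Proof.
rewrite -premor_height => /offset_cover[e r /andP[l1 l2]].
by exists e, (k - off e); rewrite subnKC // ltn_subLR.
Qed.

Lemma code_at n x : exists (e : F n) i, i < tsize (esrc (F n) e) /\
  nth set0 (val (erng (F n) e)) (off e + i) x.
Proof.
have [T [k [TP kT Tx]]] := KR_at (KR_isKR X (pidx f n)) x.
have [e [i [r E ie]]] := @code_cover n [` TP]%fset k kT.
by exists e, i; rewrite r E.
Qed.

Lemma off_lt n (e : F n) i :
  i < tsize (esrc (F n) e) -> off e + i < size (val (erng (F n) e)).
Proof. by move=> ie; apply: leq_trans (offset_tsize e); rewrite ltn_add2l. Qed.

(** The point x determines [e] and [i], as cells and offset intervals are disjoint; hence [code n x]
    is a single cell of Y. *)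
Lemma code_in n x y (e : F n) i : i < tsize (esrc (F n) e) ->
  nth set0 (val (erng (F n) e)) (off e + i) x -> code n x y ->
  nth set0 (val (esrc (F n) e)) i y.
Proof.
move=> ie ex [e' [i' [ie' ex' ey']]].
have [/val_inj r E] := KR_disjoint (KR_isKR X _) (valP _) (valP _)
  (off_lt ie) (off_lt ie') ex ex'.
by have [-> ->] := covers_inj (@spaced_offset _ _ (F n) _) r ie ie' E.
Qed.

Lemma code_dec n x y : code n.+1 x y -> code n x y.
Proof.
case=> e' [i' [ie' ex ey]].
have [S [j [SP jS Sy]]] := KR_at (KR_isKR Y n) y.
have [|ji oc] := KR_occurs_at (@shift_inj _ Y) (KR_isKR Y n) (KR_isKR Y n.+1)
  (@KR_refined _ Y n) (@KR_top_sub _ Y n) SP (valP _) jS ie'; first by exists y.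
have [e [es sub]] := premor_nested (oc : occurs (val [` SP]%fset) _ _).
exists e, j; rewrite es; split=> //.
by apply: (sub j jS); rewrite subnK.
Qed.

Lemma code_closed n x : closed [set y | code n x y].
Proof.
have hY := KR_isKR Y n.
apply: (KR_saturated_closed hY) => A y nA Ay [e [i [ie ex ey]]] z Az.
exists e, i; split=> //.
by rewrite -(KR_cell_eq hY nA (KR_nth (valP _) ie) Ay ey).
Qed.

Lemma code_limit x : exists y, forall n, code n x y.
Proof.
apply: compact_nested (@carrier_compact _ Y) _ _ _ => [n|n|n y].
- exact: code_closed.
- have [e [i [ie ex]]] := code_at n x.
  have [[y ey] _] := KR_cell (KR_isKR Y n) (KR_nth (valP _) ie).
  by exists y, e, i.
- exact: code_dec.
Qed.

Definition limit_fun (x : X) : Y := projT1 (cid (code_limit x)).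

Lemma limit_code n x : code n x (limit_fun x).
Proof. exact: (projT2 (cid (code_limit x)) n). Qed.

Lemma limit_in n (e : F n) i x : i < tsize (esrc (F n) e) ->
  nth set0 (val (erng (F n) e)) (off e + i) x ->
  nth set0 (val (esrc (F n) e)) i (limit_fun x).
Proof. by move=> ie ex; apply: code_in ex (limit_code n x). Qed.

Lemma limit_continuous : continuous limit_fun.
Proof.
move=> x U /((KR_basis Y).2 (limit_fun x))[A [[n _ nA] Ax] AU].
have [e [i [ie ex ey]]] := limit_code n x.
rewrite (KR_cell_eq (KR_isKR Y n) nA (KR_nth (valP _) ie) Ax ey) in AU.
have [_ [oB _]] := KR_cell (KR_isKR X _) (KR_nth (valP _) (off_lt ie)).
apply: (@filterS _ _ _ (nth set0 (val (erng (F n) e)) (off e + i))).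
  by move=> z ez; apply: AU; apply: limit_in.
by apply: open_nbhs_nbhs; split.
Qed.

(** The interval of [e] contains the last level of its tower and cannot go beyond it, so that level
    is also the last one of the source of [e]. *)
Lemma limit_top n x : top (KR X (pidx f n)) x -> top (KR Y n) (limit_fun x).
Proof.
move=> [T TP]; rewrite -nth_last => Tx.
have T0 := KR_height (KR_isKR X _) TP.
have [|e [i [r E ie]]] := @code_cover n [` TP]%fset (size T).-1.
  by rewrite /tsize /= prednK.
exists (val (esrc (F n) e)); first exact: valP.
rewrite -nth_last; suff <- : i = (tsize (esrc (F n) e)).-1.
  by apply: limit_in => //; rewrite r E.
apply/eqP; rewrite -eqSS prednK ?tsize_gt0 // eqn_leq ie /=.
rewrite -(leq_add2l (off e)) addnS E prednK //.
by have := offset_tsize e; rewrite r.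
Qed.

Lemma limit_bottom n x : bottom (KR X (pidx f n)) x -> bottom (KR Y n) (limit_fun x).
Proof.
move=> [T TP]; rewrite -nth0 => Tx; have T0 := KR_height (KR_isKR X _) TP.
have [e [i [r /eqP E ie]]] := @code_cover n [` TP]%fset 0 T0.
move: E; rewrite addn_eq0 => /andP[/eqP e0 /eqP i0]; subst i.
exists (val (esrc (F n) e)); first exact: valP.
by rewrite -nth0; apply: limit_in => //; rewrite r e0.
Qed.

Lemma limit_shift_level n x :
  (exists A, [/\ cells (KR Y n) A, A (limit_fun (shift X x)) &
     A (shift Y (limit_fun x))]) \/
  (top (KR Y n) (limit_fun x) /\ bottom (KR Y n) (limit_fun (shift X x))).
Proof.
have [e [i [ie ex ey]]] := limit_code n x.
have hX := KR_isKR X (pidx f n); have hY := KR_isKR Y n.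
set T := erng (F n) e in ex; set S := esrc (F n) e in ie ey.
(* Below the last level of [S], the point and its value both climb one level. *)
have [iS|iS] := ltnP i.+1 (tsize S).
  left; exists (nth set0 (val S) i.+1); split.
  - exact: KR_nth (valP _) iS.
  - apply: limit_in => //; rewrite addnS.
    rewrite -(KR_shift hX (valP _)); last by rewrite -addnS off_lt.
    by exists x.
  - by rewrite -(KR_shift hY (valP S) iS); exists (limit_fun x).
have {}iS : i.+1 = tsize S by apply/eqP; rewrite eqn_leq ie.
right; split.
  by exists (val S); [exact: valP|rewrite -nth_last -[size _]iS].
(* Now [S] is exhausted. Either [T] ends too and x goes to a bottom of X, or the next level of [T]
   is covered by some edge [e']. *)
have := off_lt ie; rewrite leq_eqVlt => /predU1P[lT|ltT].
  apply: limit_bottom; rewrite -(KR_top hX); exists x => //.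
  by exists (val T); [exact: valP|rewrite -nth_last -lT].
have [e' [i' [r E ie']]] := code_cover ltT.
have ex' : nth set0 (val (erng (F n) e')) (off e' + i') (shift X x).
  by rewrite r E -(KR_shift hX (valP T) ltT); exists x.
have i'0 : i' = 0.
  (* The level reached lies beyond [e] and all smaller edges, so [e'] comes after [e]; its offset is
     at least this level, which forces [i'] to be 0. *)
  have [ee'|/(offset_elt (@tsize _ Y n)) l|/(offset_elt (@tsize _ Y n)) l] := elt_total r.
  - move: E ie'; rewrite ee' -addnS => /addnI ->.
    by rewrite [tsize _]/(tsize S) iS ltnn.
  - have : off e' + i' < off e by apply: leq_trans l; rewrite ltn_add2l.
    by rewrite E ltnNge -ltnS ltnS -addnS leq_addr.
  - apply/eqP; rewrite -leqn0 -(leq_add2l (off e')) addn0 E -addnS iS; exact: l.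
exists (val (esrc (F n) e')); first exact: valP.
by rewrite -nth0 -i'0; apply: limit_in.
Qed.

(** If the top-to-bottom alternative holds at all levels, both sides are the image of the base
    point. If it fails at some N it fails at all later levels, tops and bottoms being decreasing,
    and [KR_separated] applies. *)
Lemma limit_shift x : limit_fun (shift X x) = shift Y (limit_fun x).
Proof.
have [tb|ntb] := pselect (forall n, top (KR Y n) (limit_fun x) /\
    bottom (KR Y n) (limit_fun (shift X x))).
  rewrite (top_base (fun n => (tb n).1)).
  have [z zt] : exists z, forall n, top (KR Y n) z /\
      shift Y z = limit_fun (shift X x).
    have [_ [psi [_ psiK _]]] := shift_homeo Y.
    exists (psi (limit_fun (shift X x))) => n; rewrite psiK; split=> //.
    have [_] := tb n; rewrite -(KR_top (KR_isKR Y n)) => -[z zt zE].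
    by rewrite -zE in psiK *; rewrite (shift_inj (psiK _)).
  by rewrite -(zt 0).2 (top_base (fun n => (zt n).1)).
have [N ntN] : exists N, ~ (top (KR Y N) (limit_fun x) /\
    bottom (KR Y N) (limit_fun (shift X x))) by apply/existsNP.
apply: KR_separated; exists N => n Nn.
have [//|[t b]] := limit_shift_level n x; case: ntN; split.
  exact: KR_top_le Nn _ t.
move: b; rewrite -!(KR_top (KR_isKR Y _)) => -[z zt <-].
by exists z => //; apply: KR_top_le Nn _ zt.
Qed.

Lemma limit_base : limit_fun (base X) = base Y.
Proof. by apply: top_base => n; apply: limit_top; apply: KR_base (KR_isKR X _). Qed.

Definition limit_map : sds_map X Y :=
  SdsMap limit_continuous limit_shift limit_base.

(** Offsets serve as positions. If the inverse image of S occurs at k, pick x at level k: the edge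
    covering that level has a source containing the value of x at some level i, and disjointness of
    cells gives source S and i = 0. *)
Lemma premor_map_edges n : F n =~ map_edges limit_map n (pidx f n).
Proof.
have size_gt0 (S : KR Y n) : 0 < size (preim_tower limit_map (val S)).
  by rewrite size_map; apply: tsize_gt0.
apply: (@eiso_occ _ _ _ _ _ _ size_gt0 (F n) (offset (@tsize _ Y n))).
- move=> e; split; first by rewrite size_map; apply: offset_tsize.
  move=> j; rewrite size_map => je x ex; rewrite nth_preim.
  exact: limit_in.
- move=> S T k [kT ST]; have S0 := size_gt0 S.
  have {}kT : k < size (val T).
    by apply: leq_trans kT; rewrite -addn1 leq_add2l.
  have [[x Tx] _] := KR_cell (KR_isKR X _) (KR_nth (valP T) kT).
  have [e [i [r E ie]]] := code_cover (kT : k < tsize T).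
  have Sx : nth set0 (val S) 0 (limit_fun x).
    by have := ST 0 S0; rewrite addn0 nth_preim; apply.
  rewrite -E -r in Tx; have ex := limit_in ie Tx.
  have [/val_inj es i0] := KR_disjoint (KR_isKR Y n) (valP _) (valP S) ie
    (tsize_gt0 S) ex Sx.
  by exists e; split=> //; rewrite -E i0 addn0.
- move=> e e' r E.
  by have [] := covers_inj (@spaced_offset _ _ (F n) _) r (tsize_gt0 _)
    (tsize_gt0 _) (congr1 (addn^~ 0) E).
- move=> e e' ee'; have [->//|ne] := eqVneq e e'.
  have : elt e e' by rewrite /elt ne.
  by move=> /(offset_elt (@tsize _ Y n)); apply: leq_trans; apply: leq_addr.
Qed.

Lemma limit_refined n : refined (preim_KR limit_map n) (KR X (pidx f n)).
Proof.
move=> _ [T TP /(nthP set0)[k kT <-]].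
have [e [i [r E ie]]] := @code_cover n [` TP]%fset k kT.
exists (limit_map @^-1` nth set0 (val (esrc (F n) e)) i).
  rewrite cells_preim; exists (nth set0 (val (esrc (F n) e)) i) => //.
  exact: KR_nth (valP _) ie.
by move=> x Tx; apply: limit_in => //; rewrite r E.
Qed.

End LimitMap.

Section TransportPremor.
Variables (B C : obd) (f : premor B C).
Variable G : forall n, edge_set (vtx B n) (vtx C (pidx f n)).
Hypothesis fG : forall n, pedg f n =~ G n.

Lemma transport_gt0 n : 0 < #|G n|.
Proof.
have /card_gt0P[e _] := pedg_gt0 f n; have [h _] := fG n.
by apply/card_gt0P; exists (h e).
Qed.

Lemma transport_src n v : exists e : G n, esrc (G n) e = v.
Proof.
have [e ev] := pedg_src f v; have [h [_ hs _ _]] := fG n.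
by exists (h e); rewrite hs.
Qed.

Lemma transport_rng n w : exists e : G n, erng (G n) e = w.
Proof.
have [e ew] := pedg_rng w; have [h [_ _ hr _]] := fG n.
by exists (h e); rewrite hr.
Qed.

Lemma transport0_card : #|G 0| = 1.
Proof.
by have [h [hb _ _ _]] := fG 0; rewrite -(bij_eq_card hb) pedg0_card.
Qed.

Lemma transport_comm n :
  edg B n \oE G n.+1 =~ G n \oE epath C (pidx f n) (pidx f n.+1).
Proof.
apply: eiso_trans (eiso_compr _ (eiso_sym (fG n.+1))) _.
exact: eiso_trans (pedg_comm f n) (eiso_compl _ (fG n)).
Qed.

(** [represents] asks for equal edge sets, not isomorphic ones, so those of [f] are exchanged for
    the edge sets of the limit map. *)
Definition transport_premor : premor B C :=
  @Premor B C (pidx f) G (pidx0 f) (pidx_le f) (pidx_unbounded f)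
    transport_gt0 transport_src transport_rng transport0_card transport_comm.

Lemma transport_pequiv : pequiv transport_premor f.
Proof.
apply/pequivP => n; exists (pidx f n); split=> //.
exact/eiso_compl/eiso_sym/fG.
Qed.

End TransportPremor.

Lemma represents_full (R : realType) (X Y : sds R)
    (f : premor (sds_diagram Y) (sds_diagram X)) :
  exists (a : sds_hom X Y) g, represents (sval a) g /\ pequiv g f.
Proof.
have fa := premor_map_edges f; pose g := transport_premor fa.
have ga : represents (limit_map f) g.
  move=> n; split=> //; first exact: limit_refined.
  by rewrite top_preim => x; apply: (@limit_top _ _ _ f n).
(* Surjectivity of the limit map is read off from the premorphism [g] that represents it. *)
exists (exist _ (limit_map f) (represents_surj ga)), g; split=> //.
exact: transport_pequiv.
Qed.

Theorem theorem3p8 (R : realType) :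
  exists P : forall X Y : SDS R, hom X Y -> hom (sds_diagram Y) (sds_diagram X),
    [/\ is_P P, is_contrafunctor P, is_full P & is_faithful P].
Proof.
(* A representing premorphism is chosen for each map; [represents_pequiv] makes its class
   independent of the choice. *)
pose rep (X Y : SDS R) (a : hom X Y) := projT1 (cid (represents_ex (svalP a))).
have repP (X Y : SDS R) (a : hom X Y) : represents (sval a) (rep X Y a).
  exact: (projT2 (cid (represents_ex (svalP a)))).
pose P (X Y : SDS R) (a : hom X Y) :
  hom (sds_diagram Y : OBD) (sds_diagram X) := pclass (rep X Y a).
exists P; split.
- move=> X Y a; split=> [|f fa]; first by exists (rep X Y a).
  by apply/pclassP/(represents_pequiv (svalP a)).
- split=> [X|X Y Z b a].
    by apply/pclassP/represents_id; apply: repP.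
  rewrite /P /= obd_cmpE; apply/pclassP.
  exact: represents_comp (repP _ _ b) (repP _ _ a) (repP _ _ _).
- move=> X Y m; have [f ->] := obd_homP m.
  have [a [g [ga gf]]] := represents_full f; exists a; apply/pclassP.
  exact: pequiv_trans (represents_pequiv (svalP a) (repP _ _ _) ga) gf.
- by move=> X Y a b /pclassP; apply: represents_faithful (repP _ _ a) (repP _ _ b).
Qed.
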